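(* There exist $c_1=c_1(N,\vec h)$ and $c_2=c_2(N,\vec h)$ (depending only on $N$ and $\vec h$) such that, setting $$r(N,\vec h):=c_1N-c_2\log N,$$ for $\mathbb{P}$-almost all $\vec h$, the point process $(H_N(\sigma)-r(N,\vec h),\ \sigma\in\Sigma_N)$ on $\mathbb{R}$, conditioned on $\vec h$, converges weakly as $N\to\infty$ to a Poisson process on $\mathbb{R}$ with intensity $Ce^{-\beta_c z}\,dz$, for some explicit deterministic constant $C>0$. Moreover, $\mathbb{P}$-almost surely, $$c_1(N,\vec h)\to E_{\max},\qquad c_2(N,\vec h)\to\frac{1}{2\beta_c}\qquad\text{as }N\to\infty.$$
   Context: For $N\in\mathbb{N}$ let $\Sigma_N=\{-1,+1\}^N$. On a probability space $(\Omega,\mathcal{F},\mathbb{P})$ with expectation $\mathbb{E}$ are defined: for each $N$, a family $X_N=(X_N(\sigma),\sigma\in\Sigma_N)$ of i.i.d. centered Gaussian random variables of variance $N$; and a sequence $\vec h=(h_i,i\in\mathbb{N})$ of i.i.d. real random variables independent of the $X_N$'s, with $\mathbb{E}[\exp(t h_1)]<\infty$ for all $t\in\mathbb{R}$. The Hamiltonian is $$H_N(\sigma)=X_N(\sigma)+Y_N(\sigma),\qquad Y_N(\sigma)=\sum_{i=1}^N h_i\sigma_i,\qquad \sigma\in\Sigma_N.$$ The number $\beta_c$ is given by the self-consistency equation $$\beta_c=\sqrt{2\Big(\log 2-\big(\beta_c\,\mathbb{E}[h_1\tanh \beta_c h_1]-\mathbb{E}[\log\cosh\beta_c h_1]\big)\Big)},$$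 and $E_{\max}=\beta_c+\mathbb{E}[h_1\tanh\beta_c h_1]$. Weak convergence of point processes is understood as convergence of Laplace functionals against continuous, compactly supported, nonnegative test functions $\phi:\mathbb{R}\to[0,\infty)$; here it means that, for $\mathbb{P}$-almost all $\vec h$, $\mathbb{E}[\exp(-\sum_{\sigma}\phi(H_N(\sigma)-r(N,\vec h)))\mid\vec h]\to\exp\left(-\int_{\mathbb{R}}(1-e^{-\phi(z)})Ce^{-\beta_c z}dz\right)$ for all such $\phi$. *)

(* Defs.v *)
From HB Require Import structures.
From mathcomp Require Import all_boot all_order all_algebra.
From mathcomp Require Import all_classical all_reals all_analysis.

Set Implicit Arguments.
Unset Strict Implicit.
Unset Printing Implicit Defensive.
Import Order.TTheory GRing.Theory Num.Theory.
Import numFieldNormedType.Exports.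
Local Open Scope classical_set_scope.
Local Open Scope ring_scope.

Definition cosh (R : realType) (x : R) : R := (expR x + expR (- x)) / 2.
Definition sinh (R : realType) (x : R) : R := (expR x - expR (- x)) / 2.
Definition tanh (R : realType) (x : R) : R := sinh x / cosh x.

(* The product sigma-algebra on R^I, for an arbitrary index type I. *)
Definition cylinders (I : Type) (R : realType) : set (set (I -> R)) :=
  [set A | exists i, exists2 B : set R, measurable B &
     A = (fun x : I -> R => x i) @^-1` B].
Definition path_space (I : Type) (R : realType) :=
  g_sigma_algebraType (@cylinders I R).

(* The family X seen as a random element of R^I. *)
Definition sample_path (I T : Type) (R : realType) (X : I -> T -> R) (w : T)
  : path_space I R := fun i => X i w.

Definition independent_family d (T : measurableType d) (R : realType)
    (P : probability T R) (I : eqType) (X : I -> T -> R) : Prop :=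
  forall (s : seq I) (A : I -> set R), uniq s -> (forall i, measurable (A i)) ->
  P [set w | forall i, i \in s -> A i (X i w)]
  = (\prod_(i <- s) P (X i @^-1` A i))%E.

Definition independent_pair d (T : measurableType d) (R : realType)
    (P : probability T R) d1 (T1 : measurableType d1) d2
    (T2 : measurableType d2) (Y : T -> T1) (Z : T -> T2) : Prop :=
  forall (A : set T1) (B : set T2), measurable A -> measurable B ->
  P (Y @^-1` A `&` Z @^-1` B) = (P (Y @^-1` A) * P (Z @^-1` B))%E.

(* k is a regular conditional law of Y given Z under P. *)
Definition cond_law d (T : measurableType d) (R : realType)
    (P : probability T R) d1 (T1 : measurableType d1) d2
    (T2 : measurableType d2) (Y : T -> T2) (Z : T -> T1)
    (k : R.-pker T1 ~> T2) : Prop :=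
  forall (B : set T1) (A : set T2), measurable B -> measurable A ->
  (\int[P]_(w in Z @^-1` B) k (Z w) A)%E = P (Z @^-1` B `&` Y @^-1` A).

(* {-1,+1}^N, with a sign stored as a boolean: false is +1 and true is -1. *)
Definition Sigma (N : nat) := {ffun 'I_N -> bool}.
Definition spin (R : realType) N (sigma : Sigma N) (i : 'I_N) : R :=
  (-1) ^+ sigma i.

(* The sequence h is indexed from 0: the usual h_1 is h 0. *)
Definition hamiltonian (T : Type) (R : realType)
    (X : forall N, Sigma N -> T -> R) (h : nat -> T -> R)
    (N : nat) (sigma : Sigma N) (w : T) : R :=
  X N sigma w + \sum_(i < N) h i w * spin R sigma i.

Section critical_values.
Context d (T : measurableType d) (R : realType) (P : probability T R).
Variables (h1 : T -> R) (beta : R).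

Definition mean_tanh : R :=
  fine ('E_P[fun w => (h1 w * tanh (beta * h1 w))%R])%E.
Definition mean_log_cosh : R :=
  fine ('E_P[fun w => ln (cosh (beta * h1 w))])%E.

(* Num.sqrt is 0 on negative numbers, but this adds no spurious solution:
   at beta = 0 the right-hand side is sqrt (2 * ln 2) > 0. *)
Definition self_consistent : Prop :=
  beta = Num.sqrt (2 * (ln 2 - (beta * mean_tanh - mean_log_cosh))).

Definition E_max : R := beta + mean_tanh.

End critical_values.

Definition test_function (R : realType) (phi : R -> R) : Prop :=
  [/\ continuous phi, forall x, 0 <= phi x
    & compact (closure [set x | phi x != 0])].

(* Laplace functional of the point process of the x i - r, x of law m. *)
Definition laplace_shifted (I : finType) (R : realType)
    (m : {measure set (path_space I R) -> \bar R}) (r : R) (phi : R -> R) : R :=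
  \int[m]_x expR (- \sum_(i : I) phi (x i - r)).

(* Laplace functional of the Poisson process with intensity f z dz. *)
Definition laplace_poisson (R : realType) (f phi : R -> R) : R :=
  expR (- \int[lebesgue_measure]_z ((1 - expR (- phi z)) * f z)).

(* Main.v *)
Require Import Defs.
From HB Require Import structures.
From mathcomp Require Import all_boot all_order all_algebra.
From mathcomp Require Import all_classical all_reals all_analysis.
From mathcomp Require Import measurable_realfun ring lra.
Import Order.TTheory GRing.Theory Num.Theory.
Import numFieldNormedType.Exports.
Import HBNNSimple.
Local Open Scope classical_set_scope.
Local Open Scope ring_scope.

(** Conditionally on the field h, the energies H_N(s) are independent Gaussians
    of variance N centred at Y_N(s), so the Laplace functional of the process
    is a product of factors 1 - a(s).  Every a(s) is O(N^(-1/2)), hence the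
    product converges to exp(- lim sum_s a(s)).  The sum of the a(s) is the
    integral of the function 1 - exp(- phi(z)) against G(r + z) dz, where

      G(a) = sum_s (Gaussian density of variance N at a - Y_N(s))

    is the intensity of the energies.  So only r has to be chosen, in such a
    way that G(r + z) tends to exp(- b z), with b the critical parameter.

    Choice of r.  It is defined implicitly, as the supremum of the levels where
    G exceeds 1 ([level]), so that G(r) = 1; this yields C = 1.  Since only
    r / N -> E_max is left to check, c2 can be the constant 1/(2 b), and c1
    absorbs everything else.  No local limit theorem is needed: writing w(s)
    for the terms of G(r), which add up to 1, one has exactly

      G(r + z) = sum_s w(s) exp(- z (r - Y_N(s)) / N - z^2 / (2 N)),

    and it suffices that (r - Y_N(s)) / N tends to b in w-probability.

    Concentration.  With u = a / N and v = Y_N(s) / N,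

      (u - v)^2 = (u - v - b)^2 + 2 b (u - v) - b^2,

    so up to the Gaussian peak a term of G(a) is at most
    exp(N b^2 / 2 - b a) exp(b Y_N(s)) ([gauss_split]).  The sum over s of the
    exp(t Y_N(s)) is an explicit product over sites ([sum_expR_field_energy]);
    its logarithm divided by N tends to psi(t) = ln 2 + E(ln cosh(t h)).  The
    derivative of psi at b is m = E(h tanh(b h)) ([mean_lncosh_add_le]), so
    Chernoff's bound shows that Y_N / N concentrates exponentially fast at m
    under the tilt by b ([energy_concentration]).  The self-consistency equation
    is psi(b) = b^2 / 2 + b m: it makes G(N (b + m)) neither grow nor decay
    exponentially, whence r / N -> b + m = E_max ([cvg_level]) and then
    G(r + z) -> exp(- b z) ([cvg_intensity_level]).

    Probability.  The averages of ln cosh(t h) converge almost surely by a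
    strong law which, thanks to exponential moments, follows from geometric
    bounds and Borel-Cantelli ([ae_mean_cvg0]).  A conditional law of H_N given
    h is identified, for almost every h, with the law of X_N + Y_N(h) for
    frozen h, by comparing both on a countable generating family of sets stable
    under intersection ([cond_law_independent]). *)

(** * Change of measure and expectations of independent products *)

(** One statement for two uses: a law given by a density (Z the identity), and
    the factorization of an expectation, where W is the product of the other
    factors.  Both sides agree on indicators, hence on simple functions, and
    monotone convergence does the rest. *)
Lemma ge0_integral_reweight d1 (T1 : measurableType d1) d2 (T2 : measurableType d2)
    (R : realType) (mu : {measure set T1 -> \bar R}) (nu : {measure set T2 -> \bar R})
    (Z : T1 -> T2) (W : T1 -> R) (c : R) :
  measurable_fun setT Z -> measurable_fun setT W -> (forall x, 0 <= W x) ->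
  0 <= c ->
  (forall B, measurable B -> \int[mu]_(x in Z @^-1` B) (W x)%:E = c%:E * nu B)%E ->
  forall f : T2 -> R, measurable_fun setT f -> (forall x, 0 <= f x) ->
  (\int[mu]_x (W x * f (Z x))%:E = c%:E * \int[nu]_x (f x)%:E)%E.
Proof.
move=> mZ mW W0 c0 WB f mf f0.
have mpre B : measurable B -> measurable (Z @^-1` B).
  by move=> mB; rewrite -[_ @^-1` _]setTI; exact: mZ.
have mindZ (g : {nnsfun T2 >-> R}) r :
    measurable_fun setT (fun x => \1_(g @^-1` [set r]) (Z x) : R).
  have -> : (fun x => \1_(g @^-1` [set r]) (Z x) : R) = \1_(Z @^-1` (g @^-1` [set r])).
    by apply/funext => x; rewrite !indicE.
  by apply: measurable_indic; exact: mpre.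
have simple (g : {nnsfun T2 >-> R}) :
    (\int[mu]_x (W x * g (Z x))%:E = c%:E * \int[nu]_x (g x)%:E)%E.
  transitivity (\int[mu]_x (\sum_(r \in range g)
      ((W x)%:E * (r * \1_(g @^-1` [set r]) (Z x))%:E)))%E.
    apply: eq_integral => x _; rewrite (fimfunE g) EFinM -fsumEFin//.
    rewrite ge0_mule_fsumr// => r; exact: nnfun_muleindic_ge0.
  rewrite ge0_integral_fsum//; last 2 first.
  - move=> r; apply: emeasurable_funM => //; first exact/measurable_EFinP.
    apply/measurable_EFinP; apply: measurable_funM => //.
  - by move=> r x _; rewrite mule_ge0 ?lee_fin//; exact: nnfun_muleindic_ge0.
  under [in RHS]eq_integral do rewrite (fimfunE g) -fsumEFin//.
  rewrite ge0_integral_fsum//; last 2 first.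
  - move=> r; apply/measurable_EFinP; exact: measurable_funM.
  - by move=> r x _; rewrite EFinM nnfun_muleindic_ge0.
  rewrite ge0_mule_fsumr//; last first.
    by move=> r; apply: integral_ge0 => x _; rewrite EFinM nnfun_muleindic_ge0.
  apply: eq_fsbigr => r; rewrite inE => -[x _ <-].
  have gx0 : (0 <= g x)%R by [].
  under eq_integral do rewrite EFinM muleCA.
  rewrite ge0_integralZl//; last 2 first.
  - apply: emeasurable_funM => //; first exact/measurable_EFinP.
    exact/measurable_EFinP.
  - by move=> y _; rewrite mule_ge0// lee_fin.
  under [in RHS]eq_integral do rewrite EFinM.
  rewrite ge0_integralZl//; last exact/measurable_EFinP.
  rewrite integral_indic//= setIT muleCA -WB//; congr (_ * _)%E.
  rewrite [RHS]integral_mkcond; apply: eq_integral => y _.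
  rewrite patchE /= indicE [Z y \in _](_ : _ = (y \in Z @^-1` (g @^-1` [set g x])))//.
  case: ifPn => _.
  - by rewrite mule1.
  - by rewrite mule0.
have mf' : measurable_fun setT (EFin \o f) by exact/measurable_EFinP.
pose h := nnsfun_approx measurableT mf'.
have cvgh x : EFin \o (h ^~ x) @ \oo --> (f x)%:E.
  by apply: (@cvg_nnsfun_approx _ _ _ _ measurableT (EFin \o f)) => // y _; rewrite lee_fin.
have ndh x : {homo (fun n => h n x) : m n / (m <= n)%N >-> m <= n}.
  by move=> m n mn; exact/lefP/nd_nnsfun_approx.
transitivity (\int[mu]_x limn (fun n => (W x * h n (Z x))%:E))%E.
  apply: eq_integral => x _; apply/esym/cvg_lim => //.
  under eq_fun do rewrite EFinM; rewrite EFinM.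
  apply: cvgeZl => //; exact: cvgh.
rewrite monotone_convergence//; last 3 first.
- move=> n; apply/measurable_EFinP; apply: measurable_funM => //.
  exact: (measurableT_comp (f := h n)).
- by move=> n x _; rewrite lee_fin mulr_ge0.
- by move=> x _ m n mn; rewrite lee_fin ler_wpM2l//; exact: ndh.
transitivity (limn (fun n => c%:E * \int[nu]_x (h n x)%:E))%E.
  by congr (limn _); apply/funext => n; exact: simple.
have nd : {homo (fun n => \int[nu]_x (h n x)%:E)%E : m n / (m <= n)%N >-> (m <= n)%E}.
  move=> m n mn; apply: ge0_le_integral => //.
  - by move=> x _; rewrite lee_fin.
  - exact/measurable_EFinP.
  - exact/measurable_EFinP.
  - by move=> x _; rewrite lee_fin; exact: ndh.
rewrite limeMl//; last exact: ereal_nondecreasing_is_cvgn.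
  congr (c%:E * _)%E; rewrite -monotone_convergence//.
  - apply: eq_integral => x _; apply/cvg_lim => //; exact: cvgh.
  - by move=> n; exact/measurable_EFinP.
  - by move=> n x _; rewrite lee_fin.
  - by move=> x _ m n mn; rewrite lee_fin; exact: ndh.
Qed.

Lemma measurable_forall_in d (T : measurableType d) (I : eqType) (s : seq I)
    (B : I -> set T) :
  (forall i, measurable (B i)) -> measurable [set w | forall i, i \in s -> B i w].
Proof.
move=> mB; elim: s => [|i s IH].
  by rewrite (_ : [set w | _] = setT)//; apply/seteqP; split.
rewrite (_ : [set w | _] = B i `&` [set w | forall i, i \in s -> B i w]).
  exact: measurableI.
apply/seteqP; split => w /=.
  by move=> h; split=> [|j js]; apply: h; rewrite inE ?eqxx// js orbT.
by move=> [Bi h] j; rewrite inE => /predU1P[->//|]; exact: h.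
Qed.

(** Independence is the product rule for indicators.  The indicators are turned
    into arbitrary nonnegative functions one index at a time: with the other
    factors frozen, both sides are measures in the set attached to that index,
    and [ge0_integral_reweight] passes from sets to functions. *)
Lemma expectation_prod_independent d (T : measurableType d) (R : realType)
    (P : probability T R) (I : eqType) (X : I -> {RV P >-> R}) :
  independent_family P (fun i => X i : T -> R) ->
  forall (s : seq I) (f : I -> R -> R) (e : I -> R), uniq s ->
  (forall i, measurable_fun setT (f i)) -> (forall i x, 0 <= f i x) ->
  (forall i, i \in s -> \int[P]_w (f i (X i w))%:E = (e i)%:E)%E ->
  (\int[P]_w (\prod_(i <- s) f i (X i w))%:E = (\prod_(i <- s) e i)%:E)%E.
Proof.
move=> Xind s f e us mf f0 fe.
have [l] : exists l : seq I, forall i, i \in s -> i \notin l ->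
    exists2 A, measurable A & f i = \1_A by exists s => i ->.
elim: l f e mf f0 fe => [|i l IH] f e mf f0 fe find.
- (* If f i is an indicator, it is the indicator of the set where it is 1. *)
  pose A i := f i @^-1` [set 1].
  have mA i : measurable (A i).
    by rewrite -[A i]setTI; apply: mf.
  have fA i : i \in s -> f i = \1_(A i).
    move=> si; have [//|B mB fB] := find i si.
    rewrite {1}fB; congr (\1_ _); apply/seteqP; split => x; rewrite /A /= fB indicE.
      by move=> Bx; rewrite mem_set.
    by case: (boolP (x \in B)) => [/set_mem//|_ /eqP]; rewrite eq_sym oner_eq0.
  have mXA i : measurable (X i @^-1` A i).
    by rewrite -[_ @^-1` _]setTI; exact: measurable_funP.
  have eA i : i \in s -> (e i)%:E = P (X i @^-1` A i).
    move=> si; rewrite -fe// fA//.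
    transitivity (\int[P]_w (\1_(X i @^-1` A i) w)%:E)%E => //.
    by rewrite integral_indic// setIT.
  rewrite -prodEFin (eq_big_seq _ eA) -Xind//.
  pose D := [set w | forall i, i \in s -> A i (X i w)].
  have mD : measurable D by exact: (@measurable_forall_in _ _ _ s (fun i => X i @^-1` A i)).
  transitivity (\int[P]_w (\1_D w)%:E)%E; last by rewrite integral_indic// setIT.
  apply: eq_integral => w _; congr (_%:E); rewrite [RHS]indicE.
  case: (boolP (w \in D)) => [/set_mem Dw|/negP Dw].
  + rewrite big_seq big1// => i si; rewrite fA// indicE mem_set//; exact: Dw.
  + have [i si Ai] : exists2 i, i \in s & ~ A i (X i w).
      apply: contrapT => h; apply: Dw; apply/mem_set => i si.
      by apply: contrapT => Ai; apply: h; exists i.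
    rewrite (perm_big _ (perm_to_rem si)) /= big_cons fA// indicE memNset//.
    by rewrite mul0r.
have [si|si] := boolP (i \in s); last first.
  apply: IH => // j sj jl; apply: find => //; rewrite inE negb_or jl andbT.
  by apply: contra si => /eqP <-.
under eq_integral do rewrite (perm_big _ (perm_to_rem si)) /= big_cons mulrC.
rewrite [in RHS](perm_big _ (perm_to_rem si)) /= big_cons mulrC EFinM.
have e0 j : j \in s -> 0 <= e j.
  by move=> sj; rewrite -lee_fin -fe// integral_ge0// => x _; rewrite lee_fin.
have irem : i \notin rem i s by rewrite mem_rem_uniqF.
have mW : measurable_fun setT (fun w => \prod_(j <- rem i s) f j (X j w)).
  by apply: measurable_prod => j _; exact: measurableT_comp.
rewrite (@ge0_integral_reweight _ _ _ _ _ P (distribution P (X i)) (X i)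
  (fun w => \prod_(j <- rem i s) f j (X j w)) (\prod_(j <- rem i s) e j))//.
- rewrite ge0_integral_distribution//; first by rewrite [X in (_ * X)%E]fe.
  + exact/measurable_EFinP.
  + by move=> y; rewrite lee_fin.
- by move=> w; rewrite prodr_ge0.
- by rewrite big_seq prodr_ge0// => j /mem_rem; exact: e0.
- move=> B mB.
  have mXB : measurable (X i @^-1` B).
    by rewrite -[_ @^-1` _]setTI; exact: measurable_funP.
  (* Replace the factor i by the indicator of B: the induction hypothesis
     computes the integral over X i in B. *)
  pose f' j := if j == i then \1_B else f j.
  pose e' j := if j == i then fine (P (X i @^-1` B)) else e j.
  have prod' (g g' : I -> R) : (forall j, j != i -> g' j = g j) ->
     \prod_(j <- s) g' j = g' i * \prod_(j <- rem i s) g j.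
    move=> gg'; rewrite (perm_big _ (perm_to_rem si)) /= big_cons; congr (_ * _).
    by apply: eq_big_seq => j jr; apply: gg'; apply: contraTneq jr => ->.
  have := IH f' e'; rewrite (prod' e); last by move=> j ji; rewrite /e' (negbTE ji).
  rewrite /e' eqxx EFinM fineK ?fin_num_measure// muleC => <-.
  + rewrite integral_mkcond; apply: eq_integral => w _.
    rewrite (prod' (fun j => f j (X j w))); last by move=> j ji; rewrite /f' (negbTE ji).
    rewrite /f' eqxx indicE patchE [w \in _](_ : _ = (X i w \in B))//.
    by case: ifPn => _; rewrite ?mul1r ?mul0r.
  + by move=> j; rewrite /f'; case: ifP.
  + by move=> j x; rewrite /f'; case: ifP.
  + move=> j sj; rewrite /f'; case: eqP => [->|_]; last exact: fe.
    rewrite fineK ?fin_num_measure//.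
    transitivity (\int[P]_w (\1_(X i @^-1` B) w)%:E)%E => //.
    by rewrite integral_indic// setIT.
  + move=> j sj jl; rewrite /f'; case: eqP => [_|/eqP ji]; first by exists B.
    by apply: find => //; rewrite inE negb_or ji.
Qed.

(** * Path spaces and conditional laws *)

Lemma measurable_coord (I : Type) (R : realType) (i : I) :
  measurable_fun setT (fun x : path_space I R => x i : R).
Proof.
move=> _ B mB; rewrite setTI; apply: sub_sigma_algebra; exists i.
by exists B.
Qed.

Lemma measurable_fun_path d (T : measurableType d) (I : Type) (R : realType)
    (F : T -> path_space I R) :
  (forall i, measurable_fun setT (fun w => F w i : R)) -> measurable_fun setT F.
Proof.
move=> mF; apply: (@measurability _ _ T (path_space I R) setT F (@cylinders I R)) => //.
move=> _ [_ [i [B mB ->]] <-].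
by have := mF i measurableT B mB.
Qed.

(** Rational thresholds on finitely many coordinates: for a countable index set
    these sets form a countable family that is stable under intersection and
    generates the product sigma-algebra. *)
Definition orthant (I : eqType) (R : realType) (l : seq (I * rat)) : set (path_space I R) :=
  [set x | forall p, p \in l -> ratr p.2 < x p.1].

Arguments orthant {I R} l _.

Lemma measurable_orthant (I : eqType) (R : realType) (l : seq (I * rat)) :
  measurable (@orthant I R l).
Proof.
apply: (@measurable_forall_in _ _ _ l (fun p (x : path_space I R) => ratr p.2 < x p.1)).
move=> p; have := @measurable_coord I R p.1 measurableT `]ratr p.2, +oo[%classic.
rewrite setTI => /(_ (measurable_itv _)).
rewrite (_ : _ @^-1` _ = [set x : path_space I R | ratr p.2 < x p.1])//.
by apply/seteqP; split => x /=; rewrite in_itv/= andbT.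
Qed.

Lemma orthant_generates (I : eqType) (R : realType) :
  @measurable _ (path_space I R) = <<s range (@orthant I R) >>.
Proof.
apply/seteqP; split; last first.
  apply: smallest_sub; first exact: sigma_algebra_measurable.
  by move=> _ [l _ <-]; exact: measurable_orthant.
apply: smallest_sub; first exact: smallest_sigma_algebra.
move=> _ [i [B mB ->]].
suff : measurable_fun setT
    (fun x : g_sigma_algebraType (range (@orthant I R)) => x i : R).
  by move=> /(_ measurableT B mB); rewrite setTI.
apply: (measurability _ (RGenOInfty.measurableE R)) => _ [_ [a ->] <-].
rewrite setTI.
have -> : (fun x : g_sigma_algebraType (range (@orthant I R)) => x i : R) @^-1`
     `]a, +oo[%classic
   = \bigcup_(q in [set q : rat | a < ratr q]) orthant [:: (i, q)].
  apply/seteqP; split => x /=.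
    rewrite in_itv/= andbT => ax; have [q /itvP qax] := rat_in_itvoo ax.
    by exists q; rewrite /= ?qax// => p; rewrite inE => /eqP ->; rewrite /= qax.
  move=> [q /= aq /(_ (i, q))]; rewrite in_itv /= andbT inE eqxx => /(_ isT).
  exact: lt_trans.
rewrite bigcup_mkcond; apply: countable_bigcupT_measurable => // q.
case: ifP => _; last exact: measurable0.
by apply: sub_sigma_algebra; exists [:: (i, q)].
Qed.

Lemma orthant_setI (I : eqType) (R : realType) : setI_closed (range (@orthant I R)).
Proof.
move=> _ _ [l1 _ <-] [l2 _ <-]; exists (l1 ++ l2) => //.
apply/seteqP; split => x /=.
  by move=> h; split => p pl; apply: h; rewrite mem_cat pl ?orbT.
by move=> [h1 h2] p; rewrite mem_cat => /orP[]; [exact: h1|exact: h2].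
Qed.

Section pair_law.
Context d (T : measurableType d) (R : realType) (P : probability T R)
  d1 (T1 : measurableType d1) d2 (T2 : measurableType d2)
  (U : {mfun T >-> T1}) (V : {mfun T >-> T2}).
Hypothesis UV : independent_pair P U V.

(** The joint law of an independent pair is the product of the marginals. *)
Lemma probability_pair (E : set (T1 * T2)) : measurable E ->
  P [set w | E (U w, V w)]
  = (\int[distribution P U]_y P [set w | E (y, V w)])%E.
Proof.
move=> mE.
have mUV : measurable_fun setT (fun w => (U w, V w)) by exact: measurable_fun_pair.
pose UV' : {mfun T >-> (T1 * T2)%type} :=
  HB.pack (fun w => (U w, V w)) (isMeasurableFun.Build _ _ _ _ _ mUV).
have := @product_measure_unique _ _ _ _ _ (distribution P U) (distribution P V)
  (distribution P UV').
move=> H; have {H} H := H (fun A B mA mB => UV A B mA mB) E mE.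
rewrite (_ : P _ = distribution P UV' E)// -H.
rewrite /product_measure1; apply: eq_integral => y _ /=.
rewrite /distribution /pushforward; congr (P _).
by apply/seteqP; split => w; rewrite /xsection /= inE.
Qed.

Lemma measurable_section_probability (E : set (T1 * T2)) : measurable E ->
  measurable_fun setT (fun y => P [set w | E (y, V w)]).
Proof.
move=> mE; have := @measurable_fun_xsection _ _ _ _ _ (distribution P V) E mE.
apply: eq_measurable_fun => y _ /=.
rewrite /distribution /pushforward; congr (P _).
by apply/seteqP; split => w; rewrite /xsection /= inE.
Qed.

Lemma ae_distribution (Q : T1 -> Prop) :
  {ae distribution P U, forall y, Q y} -> {ae P, forall w, Q (U w)}.
Proof.
move=> [N [mN N0 QN]]; exists (U @^-1` N); split => //.
  by rewrite -[_ @^-1` _]setTI; exact: measurable_funP.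
by move=> w /= /QN.
Qed.

(** Conditioning a function of an independent pair on its first component
    amounts to freezing that component.  For each orthant both sides are
    densities of the same measure, so they agree off a null set; there are
    countably many orthants, so one null set serves them all, and they
    determine a probability. *)
Lemma cond_law_independent (I : countType) (Phi : T1 * T2 -> path_space I R)
    (k : R.-pker T1 ~> path_space I R) :
  measurable_fun setT Phi ->
  cond_law P (fun w => Phi (U w, V w)) U k ->
  {ae P, forall w, forall B, measurable B ->
     k (U w) B = P [set w' | B (Phi (U w, V w'))]}.
Proof.
move=> mPhi kP.
apply: (@ae_distribution (fun y => forall B, measurable B ->
  k y B = P [set w' | B (Phi (y, V w'))])).
have kle1 y B : measurable B -> (k y B <= 1)%E.
  by move=> mB; rewrite -(@prob_kernel _ _ _ _ _ k y); apply: le_measure; rewrite ?inE.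
have step l : {ae distribution P U, forall y,
    k y (orthant l) = P [set w' | orthant l (Phi (y, V w'))]}.
  have mA := @measurable_orthant I R l.
  pose E := Phi @^-1` (orthant l).
  have mE : measurable E by rewrite -[E]setTI; exact: mPhi.
  have mk : measurable_fun setT (fun y => k y (orthant l)) by exact: measurable_kernel.
  have mg := measurable_section_probability _ mE.
  have := @integral_ae_eq _ _ _ (distribution P U) setT measurableT
    (fun y => P [set w' | E (y, V w')]) (fun y => k y (orthant l)).
  move=> /(_ _ mg) H; apply: filterS (H _ _) => [y /(_ Logic.I)//||].
    apply: (@le_integrable _ _ _ _ _ measurableT _ (cst 1%E)) => //.
    - by move=> y _; rewrite gee0_abs// (le_trans (kle1 _ _ mA))// lee_abs.
    - exact: finite_measure_integrable_cst.
  move=> B _ mB.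
  apply/esym; transitivity (P [set w | ((B `*` setT) `&` E) (U w, V w)]).
    rewrite probability_pair; last by apply: measurableI => //; exact: measurableX.
    rewrite [LHS]integral_mkcond; apply: eq_integral => y _; rewrite patchE.
    case: ifPn => [/set_mem yB|/negP yB].
      by congr (P _); apply/seteqP; split => w /=; [|case].
    apply/esym/eqP; rewrite (_ : [set w | _] = set0) ?measure0//.
    by apply/seteqP; split => w //= [[/mem_set]].
  rewrite ge0_integral_pushforward//; last exact: measurable_funTS.
  rewrite kP//; congr (P _); apply/seteqP; split => w /=; first by move=> [[]].
  by move=> [].
have cstep : {ae distribution P U, forall y (l : seq (I * rat)),
    k y (orthant l) = P [set w' | orthant l (Phi (y, V w'))]}.
  have : {ae distribution P U, forall y (n : nat), forall l : seq (I * rat),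
      unpickle n = Some l ->
      k y (orthant l) = P [set w' | orthant l (Phi (y, V w'))]}.
    apply: ae_foralln => n; case: (unpickle n) => [l|].
      by apply: filterS (step l) => y yl l' [<-].
    exact: aeW.
  by apply: filterS => y h l; apply: (h (pickle l)); rewrite pickleK.
apply: filterS cstep => y yl B mB.
have mPhiy : measurable_fun setT (fun w => Phi (y, V w)).
  by apply: measurableT_comp => //; exact: measurable_fun_pair.
pose Phiy : {mfun T >-> path_space I R} :=
  HB.pack (fun w => Phi (y, V w)) (isMeasurableFun.Build _ _ _ _ _ mPhiy).
apply: (@measure_unique _ _ _ (range orthant) (fun=> orthant [::]) _ _ _ _
  (k y) (distribution P Phiy)) => //.
- exact: orthant_generates.
- exact: orthant_setI.

- by apply/seteqP; split => // x _; exists 0%N.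
- by move=> _ [l _ <-]; exact: yl.
- move=> _; apply: (@le_lt_trans _ _ 1%E); last exact: ltry.
  by apply: kle1; exact: measurable_orthant.
Qed.

End pair_law.

(** * Elementary inequalities for exp, cosh and tanh *)

Section elementary.
Variable R : realType.
Implicit Types x y z : R.

Lemma cosh_gt0 x : 0 < cosh x.
Proof. by rewrite /cosh divr_gt0// addr_gt0// expR_gt0. Qed.

Lemma cosh_geN x : expR (- `|x|) <= cosh x.
Proof.
rewrite /cosh ler_pdivlMr// mulr_natr mulr2n; apply: lerD; rewrite ler_expR.
  by rewrite lerNl -normrN ler_norm.
by rewrite lerN2 ler_norm.
Qed.

Lemma cosh_le x : cosh x <= expR `|x|.
Proof.
rewrite /cosh ler_pdivrMr// mulr_natr mulr2n; apply: lerD; rewrite ler_expR.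
  exact: ler_norm.
by rewrite -normrN ler_norm.
Qed.

Lemma cosh_ge_half x : expR `|x| / 2 <= cosh x.
Proof.
rewrite /cosh ler_pM2r ?invr_gt0//; have [x0|x0] := leP 0 x.
  by rewrite ger0_norm// lerDl expR_ge0.
by rewrite ltr0_norm// lerDr expR_ge0.
Qed.

Lemma norm_lncosh_le x : `|ln (cosh x)| <= `|x|.
Proof.
rewrite ler_norml -[X in X <= _ <= _]expRK -[X in _ <= _ <= X]expRK.
by rewrite !ler_ln ?posrE ?expR_gt0 ?cosh_gt0// cosh_geN cosh_le.
Qed.

Lemma normr_le_lncosh x : `|x| <= ln (cosh x) + ln 2.
Proof.
have cx := cosh_gt0 x; rewrite -lnM ?posrE// -[leLHS]expRK.
rewrite ler_ln ?posrE ?expR_gt0//; last by rewrite (mulr_gt0 cx).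
by have := cosh_ge_half x; lra.
Qed.

Lemma expR_B1_le x : `|expR x - 1| <= `|x| * expR `|x|.
Proof.
have [x0|x0] := leP 0 x.
  rewrite (ger0_norm x0) ger0_norm; last by rewrite subr_ge0 -[leLHS]expR0 ler_expR.
  have := expR_ge1Dx (- x); rewrite -(ler_pM2r (expR_gt0 x)) expRN mulVf ?gt_eqF ?expR_gt0//.
  by lra.
rewrite (@ler0_norm _ (expR x - 1)); last by rewrite subr_le0 -[leRHS]expR0 ler_expR ltW.
have := expR_ge1Dx x; have : 1 <= expR `|x| by rewrite -[leLHS]expR0 ler_expR.
rewrite (ltr0_norm x0) => h1 h2; have : - x * 1 <= - x * expR (- x).
  by rewrite ler_wpM2l// oppr_ge0 ltW.
by rewrite mulr1; lra.
Qed.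

(** Two applications of the bound exp(u) >= 1 + u.  The remainder is quadratic
    on both sides of 0; this is all that the Chernoff estimates need. *)
Lemma expR_le_quadratic x : expR x <= 1 + x + x ^+ 2 * expR `|x|.
Proof.
have h : expR x - 1 <= x * expR x.
  have := expR_ge1Dx (- x); rewrite -(ler_pM2r (expR_gt0 x)) expRN mulVf ?gt_eqF ?expR_gt0//.
  by lra.
have : x * (expR x - 1) <= `|x| * (`|x| * expR `|x|).
  apply: le_trans (ler_norm _) _; rewrite normrM ler_wpM2l//.
  exact: expR_B1_le.
by rewrite mulrA -expr2 real_normK ?num_real//; lra.
Qed.

(** A Lipschitz bound whose constant depends only on the size z of the
    arguments, so that it can be used uniformly over all configurations. *)
Lemma expR_dist_le x y z : `|x| <= z -> `|y| <= z ->
  `|expR x - expR y| <= expR (3 * z) * `|x - y|.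
Proof.
move=> xz yz.
have -> : expR x - expR y = expR y * (expR (x - y) - 1).
  by rewrite mulrBr mulr1 -expRD addrCA subrr addr0.
rewrite normrM ger0_norm ?expR_ge0//.
apply: (@le_trans _ _ (expR z * (`|x - y| * expR (2 * z)))).
  apply: ler_pM => //.
    by rewrite ler_expR (le_trans (ler_norm _)).
  apply: (le_trans (expR_B1_le _)); rewrite ler_wpM2l// ler_expR.
  by apply: (le_trans (ler_normB _ _)); lra.
rewrite mulrCA mulrC -expRD; apply: ler_wpM2r => //.
by rewrite ler_expR; lra.
Qed.

Lemma norm_tanh_le1 (x : R) : `|tanh x| <= 1.
Proof.
have := cosh_gt0 x; have e1 := expR_gt0 x; have e2 := expR_gt0 (- x).
rewrite /tanh normrM normfV => c0; rewrite (gtr0_norm c0) ler_pdivrMr// mul1r.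
by rewrite ler_norml /sinh /cosh; apply/andP; split; lra.
Qed.

Lemma tanhE (x : R) : tanh x = sinh x * expR (- ln (cosh x)).
Proof. by rewrite /tanh expRN lnK// posrE; exact: cosh_gt0. Qed.

(** The ratio cosh(x + d) / cosh(x) is an average of exp(d) and exp(- d) whose
    mean exponent is d tanh(x); bound both exponentials by their quadratic
    majorants and use ln(1 + u) <= u. *)
Lemma lncosh_add_le x d :
  ln (cosh (x + d)) <= ln (cosh x) + d * tanh x + d ^+ 2 * expR `|d|.
Proof.
have cx := cosh_gt0 x; have cxd := cosh_gt0 (x + d).
suff : cosh (x + d) <= cosh x * (1 + (d * tanh x + d ^+ 2 * expR `|d|)).
  move=> h; have h0 : 0 < 1 + (d * tanh x + d ^+ 2 * expR `|d|).
    by rewrite -(pmulr_rgt0 _ cx); exact: lt_le_trans h.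
  apply: (@le_trans _ _ (ln (cosh x * (1 + (d * tanh x + d ^+ 2 * expR `|d|))))).
    by rewrite ler_ln ?posrE// mulr_gt0.
  rewrite lnM ?posrE// -addrA lerD2l; apply: le_ln1Dx.
  by rewrite -subr_gt0 opprK addrC.
have := expR_le_quadratic d; have := expR_le_quadratic (- d).
rewrite normrN sqrrN; set q := d ^+ 2 * _ => h1 h2.
have -> : cosh x * (1 + (d * tanh x + q)) = cosh x * (1 + q) + d * sinh x.
  by rewrite /tanh; field; rewrite gt_eqF.
rewrite /cosh /sinh expRD opprD expRD.
have := ler_wpM2l (expR_ge0 x) h2; have := ler_wpM2l (expR_ge0 (- x)) h1.
by lra.
Qed.

End elementary.

(** * The intensity of the energies in a frozen field *)

Section gibbs.
Variable R : realType.
Implicit Types (y : nat -> R) (N : nat) (t a : R).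

Definition field_energy y N (s : Sigma N) : R := \sum_(i < N) y i * spin R s i.

(** The logarithm of the sum over s of exp(t Y_N(s)). *)
Definition log_mgf y N t : R := N%:R * ln 2 + \sum_(i < N) ln (cosh (t * y i)).

Definition gauss_peak N : R := normal_peak (Num.sqrt N%:R).

(** Density of the mean measure of the N-spin energies in the field y. *)
Definition intensity y N a : R :=
  \sum_(s : Sigma N) gauss_peak N * expR (- (a - field_energy y N s) ^+ 2 / (2 * N%:R)).

(** The spins do not interact in Y_N, so the sum over configurations factorizes
    over the sites. *)
Lemma sum_expR_field_energy y N t :
  \sum_(s : Sigma N) expR (t * field_energy y N s) = expR (log_mgf y N t).
Proof.
transitivity (\sum_(s : {ffun 'I_N -> bool}) \prod_(i < N) expR (t * y i * (-1) ^+ s i)).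
  apply: eq_bigr => s _; rewrite -expR_sum mulr_sumr; congr expR.
  by apply: eq_bigr => i _; rewrite mulrA.
rewrite -(bigA_distr_bigA (fun (i : 'I_N) (b : bool) => expR (t * y i * (-1) ^+ b))).
rewrite /log_mgf expRD expR_sum expRM_natl.
transitivity (\prod_(i < N) (2 * cosh (t * y i))).
  by apply: eq_bigr => i _; rewrite big_bool /= ?expr1 ?expr0 mulr1 mulrN1 /cosh; field.
rewrite big_split /= prodr_const card_ord lnK ?posrE//; congr (_ * _).
by apply: eq_bigr => i _; rewrite lnK// posrE; exact: cosh_gt0.
Qed.

Lemma field_energy_le y N (s : Sigma N) : `|field_energy y N s| <= \sum_(i < N) `|y i|.
Proof.
apply: (le_trans (ler_norm_sum _ _ _)); apply: ler_sum => i _.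
by rewrite normrM /spin normrX normrN1 expr1n mulr1.
Qed.

Lemma gauss_peak_gt0 N : (0 < N)%N -> 0 < gauss_peak N.
Proof. by move=> N0; rewrite normal_peak_gt0// gt_eqF// sqrtr_gt0 ltr0n. Qed.

Lemma gauss_peakE N : gauss_peak N = (Num.sqrt (2 * pi * N%:R))^-1.
Proof.
rewrite /gauss_peak /normal_peak sqr_sqrtr//; congr ((Num.sqrt _)^-1).
by rewrite -mulr_natr; ring.
Qed.

Lemma gauss_peak_le N : (0 < N)%N -> gauss_peak N <= (Num.sqrt N%:R)^-1.
Proof.
move=> N0; have N0' : 0 < N%:R :> R by rewrite ltr0n.
have p := pi_ge2 R.
rewrite gauss_peakE lef_pV2 ?posrE ?sqrtr_gt0//; last by rewrite mulr_gt0//; lra.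
by rewrite ler_wsqrtr//; nra.
Qed.

Lemma gauss_peak_ge N : (0 < N)%N -> (8 * N%:R)^-1 <= gauss_peak N.
Proof.
move=> N0; have N1 : 1 <= N%:R :> R by rewrite ler1n.
have p := pi_ge2 R; have p4 : pi <= 4 :> R by have := pihalf_lt2 R; lra.
have N8 : 0 <= 8 * N%:R :> R by lra.
rewrite gauss_peakE lef_pV2 ?posrE.
- rewrite -[leRHS]ger0_norm// -sqrtr_sqr ler_wsqrtr// expr2.
  have : 2 * pi <= 8 :> R by lra.
  by nra.
- by lra.
- by rewrite sqrtr_gt0 mulr_gt0//; lra.
Qed.

(** The square is completed around slope b: far from a - Y = b N the Gaussian
    term is much smaller than its exponential majorant. *)
Lemma gauss_split (b a Y : R) N : (0 < N)%N ->
  - (a - Y) ^+ 2 / (2 * N%:R) =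
  N%:R * (b ^+ 2 / 2) - b * a + b * Y - (a - Y - b * N%:R) ^+ 2 / (2 * N%:R).
Proof.
move=> N0; field; by rewrite pnatr_eq0 -lt0n.
Qed.

Lemma gauss_term_le (b a Y : R) N : (0 < N)%N ->
  expR (- (a - Y) ^+ 2 / (2 * N%:R)) <= expR (N%:R * (b ^+ 2 / 2) - b * a) * expR (b * Y).
Proof.
move=> N0; rewrite -expRD ler_expR (gauss_split b)// gerBl.
by rewrite divr_ge0// sqr_ge0.
Qed.

Lemma intensity_le b y N a : (0 < N)%N ->
  intensity y N a <=
  gauss_peak N * expR (N%:R * (b ^+ 2 / 2) - b * a + log_mgf y N b).
Proof.
move=> N0; rewrite expRD -sum_expR_field_energy !mulr_sumr; apply: ler_sum => s _.
by rewrite ler_wpM2l ?gauss_term_le// ltW// gauss_peak_gt0.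
Qed.

Lemma continuous_gauss N (Y : R) :
  continuous (fun a => gauss_peak N * expR (- (a - Y) ^+ 2 / (2 * N%:R))).
Proof.
have cq : continuous (fun a : R => - (a - Y) ^+ 2 / (2 * N%:R)).
  move=> a; apply: (@cvgM _ _ _ _ _ (cst (2 * N%:R)^-1)); last exact: cvg_cst.
  apply: cvgN; apply: (continuous_comp (f := fun x : R => x - Y)
    (g := fun u : R => u ^+ 2)); last exact: exprn_continuous.
  by apply: (@cvgB _ _ _ _ _ id (cst Y)); [exact: cvg_id|exact: cvg_cst].
move=> a; apply: (@cvgM _ _ _ _ (cst (gauss_peak N))); first exact: cvg_cst.
exact: (continuous_comp (cq a) (@continuous_expR R _)).
Qed.

Lemma continuous_intensity y N : continuous (intensity y N).
Proof.
apply: continuous_big => [|s _]; first exact: add_continuous.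
exact: continuous_gauss.
Qed.

Lemma gauss_peak_normal_pdf N x : (0 < N)%N ->
  normal_pdf 0 (Num.sqrt N%:R) x = gauss_peak N * expR (- x ^+ 2 / (2 * N%:R)).
Proof.
move=> N0; rewrite normal_pdfE ?gt_eqF ?sqrtr_gt0 ?ltr0n// /normal_fun subr0 sqr_sqrtr//.
by rewrite -[N%:R *+ 2]mulr_natl.
Qed.

Lemma cvg_inv_sqrt : (Num.sqrt N%:R : R)^-1 @[N --> \oo] --> 0.
Proof.
apply/cvgrPdist_le => e e0; near=> N.
have N0 : (0 < N)%N by near: N; exists 1%N.
have eN : e ^- 2 < N%:R by near: N; exact: nbhs_infty_gtr.
rewrite sub0r normrN gtr0_norm ?invr_gt0 ?sqrtr_gt0 ?ltr0n//.
rewrite -[leRHS]invrK lef_pV2 ?posrE ?invr_gt0 ?sqrtr_gt0 ?ltr0n//.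
have ei : 0 <= e^-1 by rewrite invr_ge0 ltW.
by rewrite -(ger0_norm ei) -sqrtr_sqr ler_wsqrtr// exprVn ltW.
Unshelve. all: by end_near. Qed.

Lemma gauss_peak_cvg0 : gauss_peak N @[N --> \oo] --> 0.
Proof.
apply: (squeeze_cvgr _ (cvg_cst 0) cvg_inv_sqrt); near=> N.
have N0 : (0 < N)%N by near: N; exists 1%N.
by rewrite ltW ?gauss_peak_gt0//= gauss_peak_le.
Unshelve. all: by end_near. Qed.

Lemma cvg_ln_div : ln N%:R / N%:R @[N --> \oo] --> (0 : R).
Proof.
apply: (@squeeze_cvgr _ _ _ _ (cst 0) (fun N => 2 * (Num.sqrt N%:R : R)^-1)).
- near=> N.
  have N1 : 1 <= N%:R :> R by rewrite ler1n; near: N; exists 1%N.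
  have s0 : 0 < Num.sqrt N%:R :> R by rewrite sqrtr_gt0 (lt_le_trans ltr01).
  have lnN0 : 0 <= ln N%:R / N%:R :> R by rewrite divr_ge0 ?ln_ge0.
  rewrite lnN0 /=; have := @sqr_sqrtr _ (N%:R : R) (ler0n _ _).
  move: (Num.sqrt N%:R) s0 => q q0 <-.
  rewrite lnXn// -[_ *+ 2]mulr_natl ler_pdivrMr ?exprn_gt0// expr2 mulrA divfK ?gt_eqF//.
  by rewrite ler_pM2l// ltW// ln_sublinear.
- exact: cvg_cst.
- rewrite -[X in _ --> X](mulr0 2); apply: cvgM; [exact: cvg_cst|exact: cvg_inv_sqrt].
Unshelve. all: by end_near. Qed.

End gibbs.

Arguments field_energy {R} y N s.
Arguments log_mgf {R} y N t.
Arguments intensity {R} y N a.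

(** * The level of unit intensity *)

Section level.
Variable R : realType.
Implicit Types (y : nat -> R) (N : nat).

(** Restricting the supremum to nonnegative rationals makes the level a
    countable supremum, so that it depends measurably on the field. *)
Definition level_candidate y N (n : nat) : R :=
  if unpickle n is Some q then
    if (0 <= ratr q :> R) && (1 < intensity y N (ratr q)) then ratr q else 0
  else 0.

Definition level y N : R := sups (level_candidate y N) 0.

Lemma level_candidate_cases y N n : level_candidate y N n = 0 \/
  1 < intensity y N (level_candidate y N n).
Proof.
rewrite /level_candidate; case: unpickle => [q|]; last by left.
by case: ifP => [/andP[]|]; [right|left].
Qed.

Lemma level_candidate_rat y N (q : rat) : 0 <= ratr q :> R ->
  1 < intensity y N (ratr q) -> exists n, level_candidate y N n = ratr q.
Proof.
by move=> q0 dq; exists (pickle q); rewrite /level_candidate pickleK q0 dq.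
Qed.

(** [intensity_le] with slope 1: the intensity decays at least like exp(- a). *)
Lemma level_candidate_ub y N : (0 < N)%N -> has_ubound (range (level_candidate y N)).
Proof.
move=> N0; set A := N%:R * (1 ^+ 2 / 2) + log_mgf y N 1.
exists (Num.max 0 (ln (gauss_peak R N) + A)) => _ [n _ <-].
rewrite le_max; have [->|h] := level_candidate_cases y N n; first by rewrite lexx.
have /(lt_le_trans h) := intensity_le R 1 y N (level_candidate y N n) N0.
rewrite mul1r -[gauss_peak _ _]lnK ?posrE ?gauss_peak_gt0// -expRD.
rewrite -[ltLHS]expR0 ltr_expR => h'; apply/orP; right; move: h'; rewrite -/A.
by rewrite expRK /A; lra.
Qed.

Lemma level_has_sup y N : (0 < N)%N -> has_sup (range (level_candidate y N)).
Proof. by move=> N0; split; [exists (level_candidate y N 0), 0%N|exact: level_candidate_ub]. Qed.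

Lemma levelE y N : level y N = sup (range (level_candidate y N)).
Proof. by rewrite /level /sups /sdrop; congr sup; apply/seteqP; split => x [n _ <-]; exists n. Qed.

Lemma level_candidate_le y N n : (0 < N)%N -> level_candidate y N n <= level y N.
Proof. by move=> N0; rewrite levelE; apply: sup_upper_bound; [exact: level_has_sup|exists n]. Qed.

Lemma level_ge0 y N : (0 < N)%N -> 0 <= level y N.
Proof.
move=> N0; have [q0|q0] := boolP (level_candidate y N 0 == 0).
  by rewrite -(eqP q0) level_candidate_le.
apply: le_trans (level_candidate_le y N 0 N0).
rewrite /level_candidate; case: unpickle => [q|//].
by case: ifP => // /andP[].
Qed.

Lemma intensity_above_level y N a : (0 < N)%N -> level y N < a -> intensity y N a <= 1.
Proof.
move=> N0 la; rewrite leNgt; apply/negP => da.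
have : \forall x \near a, 1 < intensity y N x /\ level y N < x.
  near=> x; split; near: x; last exact: lt_nbhsr.
  exact: (cvgr_gt _ (continuous_intensity R y N a) _ da).
move=> [e /= e0 ae].
have [q /itvP qa] : exists q, ratr q \in `]a - e, a[ by apply: rat_in_itvoo; rewrite ltrBlDr ltrDl.
have [dq lq] : 1 < intensity y N (ratr q) /\ level y N < ratr q.
  by apply: ae; rewrite /= ger0_norm ?subr_ge0 ?qa// ltrBlDl -ltrBlDr qa.
have q0 : 0 <= ratr q :> R by apply: le_trans (ltW lq); exact: level_ge0.
have [n hn] := level_candidate_rat y N q q0 dq.
by have := level_candidate_le y N n N0; rewrite hn leNgt lq.
Unshelve. all: by end_near. Qed.

(** By continuity: the level is a limit of points where the intensity exceeds
    1, while [intensity_above_level] bounds it by 1 to the right. *)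
Lemma intensity_level y N : (0 < N)%N -> 0 < level y N -> intensity y N (level y N) = 1.
Proof.
move=> N0 l0; apply/eqP; rewrite eq_le; apply/andP; split; rewrite leNgt; apply/negP => dl.
  have [e /= e0 le] := cvgr_gt _ (continuous_intensity R y N (level y N)) _ dl.
  have := intensity_above_level y N (level y N + e / 2) N0.
  rewrite ltrDl divr_gt0// => /(_ isT); rewrite leNgt le//=.
  by rewrite opprD addNKr normrN gtr0_norm ?divr_gt0//; lra.
have [e /= e0 le] := cvgr_lt _ (continuous_intensity R y N (level y N)) _ dl.
pose f := Num.min e (level y N).
have f0 : 0 < f by rewrite lt_min e0.
have [_ [n _ <-]] := sup_adherent f0 (level_has_sup y N N0); rewrite -levelE => hn.
have fe : f <= e by rewrite /f ge_min lexx.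
have fl : f <= level y N by rewrite /f ge_min lexx orbT.
have hl := level_candidate_le y N n N0.
have [h0|] := level_candidate_cases y N n; first by move: hn; rewrite h0; lra.
move=> /ltW; rewrite leNgt le//=.
by rewrite ger0_norm ?subr_ge0//; lra.
Qed.

Lemma level_le y N B : (0 < N)%N -> 0 <= B ->
  (forall a, B < a -> intensity y N a <= 1) -> level y N <= B.
Proof.
move=> N0 B0 hB; rewrite levelE; apply: ge_sup; first by exists (level_candidate y N 0), 0%N.
move=> _ [n _ <-]; have [->//|] := level_candidate_cases y N n.
by rewrite ltNge; apply: contraNle => /hB.
Qed.

Lemma level_ge y N a : (0 < N)%N -> 1 < intensity y N a -> a <= level y N.
Proof.
move=> N0 da; rewrite leNgt; apply/negP => la.
by have := intensity_above_level y N a N0 la; rewrite leNgt da.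
Qed.

End level.

(** * Asymptotics of the level and of the intensity in a typical field *)

(* The field y is deterministic here.  What is used of a typical field is the
   limit psi of the normalized log-moment generating function at b, limits at
   b +- 1/(n+1) that admit m as a slope up to a quadratic error, and bounded
   averages of the |y i|.  That psi = b^2/2 + b m is the self-consistency
   equation. *)
Section asymptotics.
Variables (R : realType) (y : nat -> R) (b m K M : R).
Hypothesis b0 : 0 < b.
Hypothesis m0 : 0 <= m.
Let psi : R := b ^+ 2 / 2 + b * m.
Hypothesis cvg_b : log_mgf y N b / N%:R @[N --> \oo] --> psi.
Hypothesis cvg_shift : forall (e : bool) (n : nat), exists2 L : R,
  L <= psi + (-1) ^+ e * n.+1%:R^-1 * m + K * n.+1%:R^-1 ^+ 2 &
  log_mgf y N (b + (-1) ^+ e * n.+1%:R^-1) / N%:R @[N --> \oo] --> L.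
Hypothesis bounded_mean : \forall N \near \oo, \sum_(i < N) `|y i| <= M * N%:R.

(** Chernoff's bound under the tilt by b. *)
Lemma energy_tail N (t v : R) (A : pred (Sigma N)) :
  (forall s, A s -> v <= t * field_energy y N s) ->
  \sum_(s : Sigma N | A s) expR (b * field_energy y N s) <= expR (log_mgf y N (b + t) - v).
Proof.
move=> Av; rewrite expRD -sum_expR_field_energy mulr_suml big_mkcond /=; apply: ler_sum => s _.
case: ifP => [/Av vt|_]; last by rewrite mulr_ge0// expR_ge0.
by rewrite -expRD ler_expR mulrDl -addrA lerDl subr_ge0.
Qed.

Let n_gt0 : \forall N \near \oo, (0 < N)%N.
Proof. by near=> N; near: N; exists 1%N. Unshelve. all: by end_near. Qed.

(** The sign (-1)^e selects the upper or the lower tail.  With an extra tilt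
    eta = 1/(n+1), Chernoff's exponent is at most - eta delta + K eta^2, which
    is negative as soon as K eta <= delta / 2. *)
Lemma energy_tail_half (e : bool) (delta : R) : 0 < delta ->
  exists2 c : R, 0 < c & \forall N \near \oo,
  \sum_(s : Sigma N | N%:R * delta < (-1) ^+ e * (field_energy y N s - N%:R * m))
    expR (b * field_energy y N s) <= expR (N%:R * (psi - c)).
Proof.
move=> d0; (* n is so large that K / n.+1 <= delta / 2. *)
pose n := Num.truncn (2 * K / delta).
have ng : 2 * K / delta < n.+1%:R by rewrite truncnS_gt.
pose eta : R := n.+1%:R^-1.
have eta0 : 0 < eta by rewrite invr_gt0 ltr0n.
have Keta : K * eta <= delta / 2.
  move: ng; rewrite ltr_pdivrMr// => ng.
  by rewrite /eta ler_pdivrMr ?ltr0n//; lra.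
have [L hL cvgL] := cvg_shift e n.
exists (eta * delta / 4); first by rewrite divr_gt0// mulr_gt0.
pose u : R := psi + (-1) ^+ e * eta * m + 3 * (eta * delta) / 4.
have Lu : L < u.
  apply: (le_lt_trans hL); rewrite -/eta /u ltrD2l.
  have : K * eta * eta <= delta / 2 * eta by rewrite ler_wpM2r// ltW.
  have : 0 < eta * delta by rewrite mulr_gt0.
  by rewrite expr2; lra.
near=> N.
have N0 : (0 < N)%N by near: N.
have N0' : 0 < N%:R :> R by rewrite ltr0n.
have Lm : log_mgf y N (b + (-1) ^+ e * eta) / N%:R < u.
  by near: N; exact: (cvgr_lt _ cvgL _ Lu).
apply: le_trans (energy_tail N ((-1) ^+ e * eta)
   (N%:R * (eta * delta + (-1) ^+ e * eta * m)) _ _) _.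
  move=> s /ltW; rewrite -(ler_pM2l eta0) => h.
  have -> : (-1) ^+ e * eta * field_energy y N s =
     eta * ((-1) ^+ e * (field_energy y N s - N%:R * m)) + N%:R * ((-1) ^+ e * eta * m) by ring.
  by rewrite mulrDr lerD2r mulrCA.
rewrite ler_expR; move: Lm; rewrite ltr_pdivrMr// => Lm.
have -> : psi - eta * delta / 4 = u - (eta * delta + (-1) ^+ e * eta * m) by rewrite /u; lra.
by rewrite mulrBr lerD2r [N%:R * u]mulrC ltW.
Unshelve. all: by end_near. Qed.

Lemma energy_concentration (delta : R) : 0 < delta ->
  exists2 c : R, 0 < c & \forall N \near \oo,
  \sum_(s : Sigma N | N%:R * delta < `|field_energy y N s - N%:R * m|)
    expR (b * field_energy y N s) <= 2 * expR (N%:R * (psi - c)).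
Proof.
move=> d0; have [c1 c10 h1] := energy_tail_half false delta d0.
have [c2 c20 h2] := energy_tail_half true delta d0.
exists (Num.min c1 c2); first by rewrite lt_min c10.
near=> N.
have N0 : 0 <= N%:R :> R by rewrite ler0n.
have f1 : \sum_(s : Sigma N | N%:R * delta < (-1) ^+ false * (field_energy y N s - N%:R * m))
    expR (b * field_energy y N s) <= expR (N%:R * (psi - c1)) by near: N.
have f2 : \sum_(s : Sigma N | N%:R * delta < (-1) ^+ true * (field_energy y N s - N%:R * m))
    expR (b * field_energy y N s) <= expR (N%:R * (psi - c2)) by near: N.
have e1 : expR (N%:R * (psi - c1)) <= expR (N%:R * (psi - Num.min c1 c2)).
  by rewrite ler_expR ler_wpM2l// lerD2l lerN2 ge_min lexx.
have e2 : expR (N%:R * (psi - c2)) <= expR (N%:R * (psi - Num.min c1 c2)).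
  by rewrite ler_expR ler_wpM2l// lerD2l lerN2 ge_min lexx orbT.
rewrite [leRHS]mulr_natl mulr2n; apply: le_trans (lerD (le_trans f1 e1) (le_trans f2 e2)).
rewrite [X in X <= _]big_mkcond [X in _ <= X + _]big_mkcond [X in _ <= _ + X]big_mkcond.
rewrite -big_split; apply: ler_sum => s _ /=.
rewrite expr0 mul1r expr1 mulN1r ltr_normr.
have e0 : 0 <= expR (b * field_energy y N s) by exact: expR_ge0.
by case: ifP => [/orP[->|->]|_]; repeat case: ifP => _;
  rewrite ?addr0 ?add0r ?lerDl ?lerDr ?addr_ge0.
Unshelve. all: by end_near. Qed.

(** At a = N (b + m) the exponent in [intensity_le] is o(N) by the
    self-consistency equation, and its slope in a is - b. *)
Lemma intensity_le1_above (eps : R) : 0 < eps -> \forall N \near \oo,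
  forall a, N%:R * (b + m + eps) <= a -> intensity y N a <= 1.
Proof.
move=> e0; near=> N => a Na.
have N0 : (0 < N)%N by near: N.
have N1 : 1 <= N%:R :> R by rewrite ler1n.
have N0' : 0 < N%:R :> R by rewrite ltr0n.
apply: (le_trans (intensity_le R b y N a N0)).
rewrite -[leRHS]mulr1; apply: ler_pM => //; first by rewrite ltW// gauss_peak_gt0.
  apply: (le_trans (gauss_peak_le R N N0)).
  by rewrite invf_le1 ?sqrtr_gt0// -[leLHS]sqrtr1 ler_wsqrtr.
rewrite -[leRHS]expR0 ler_expR.
have : log_mgf y N b / N%:R < psi + b * eps.
  by near: N; apply: (cvgr_lt _ cvg_b); rewrite ltrDl mulr_gt0.
rewrite ltr_pdivrMr// /psi => h.
have : b * (N%:R * (b + m + eps)) <= b * a by rewrite ler_pM2l.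
by lra.
Unshelve. all: by end_near. Qed.

(** The peak only decays like N^(-1/2). *)
Lemma peak_exp_large (c : R) : 0 < c -> \forall N \near \oo, 2 < gauss_peak R N * expR (c * N%:R).
Proof.
move=> c0; near=> N.
have N0 : (0 < N)%N by near: N.
have N0' : 0 < N%:R :> R by rewrite ltr0n.
have Nbig : 64 / c ^+ 2 < N%:R by near: N; exact: nbhs_infty_gtr.
have h : c * N%:R / 2 <= expR (c * N%:R / 2).
  by apply: le_trans (expR_ge1Dx _); rewrite lerDr.
have h0 : 0 <= c * N%:R / 2 by rewrite divr_ge0// mulr_ge0// ltW.
have h2 : (c * N%:R / 2) ^+ 2 <= expR (c * N%:R).
  have -> : expR (c * N%:R) = expR (c * N%:R / 2) ^+ 2.
    by rewrite expr2 -expRD; congr expR; lra.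
  by rewrite ler_sqr// nnegrE expR_ge0.
apply: (@lt_le_trans _ _ ((8 * N%:R)^-1 * (c * N%:R / 2) ^+ 2)); last first.
  apply: ler_pM => //.
  - exact: sqr_ge0.
  - exact: gauss_peak_ge.
have -> : (8 * N%:R)^-1 * (c * N%:R / 2) ^+ 2 = c ^+ 2 * N%:R / 32.
  by field; rewrite gt_eqF.
move: Nbig; rewrite ltr_pdivrMr ?exprn_gt0// => Nbig.
by rewrite ltr_pdivlMr//; lra.
Unshelve. all: by end_near. Qed.

(** Keep only the configurations with |Y_N - N m| <= N eps.  They carry at
    least half of the tilted sum, and there the completed square costs at most
    2 N eps^2, while lowering a by N eps gains N b eps. *)
Lemma intensity_gt1_below (eps : R) : 0 < eps -> eps < b / 4 ->
  \forall N \near \oo, 1 < intensity y N (N%:R * (b + m - eps)).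
Proof.
move=> e0 eb; have [c c0 conc] := energy_concentration eps e0.
(* k is the loss allowed in log_mgf: below c, so that the good part dominates,
   and below the net gain b eps - 2 eps^2 >= b eps / 2. *)
pose k : R := Num.min (c / 2) (b * eps / 4).
have be0 : 0 < b * eps by rewrite mulr_gt0.
have k0 : 0 < k by rewrite lt_min !divr_gt0.
have kc : k <= c / 2 by rewrite /k ge_min lexx.
have kb : k <= b * eps / 4 by rewrite /k ge_min lexx orbT.
have c4 : 0 < c / 2 by rewrite divr_gt0.
near=> N.
have N0 : (0 < N)%N by near: N.
have N0' : 0 < N%:R :> R by rewrite ltr0n.
have fconc : \sum_(s : Sigma N | N%:R * eps < `|field_energy y N s - N%:R * m|)
    expR (b * field_energy y N s) <= 2 * expR (N%:R * (psi - c)) by near: N.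
have Zlow : N%:R * (psi - k) <= log_mgf y N b.
  have : psi - k < log_mgf y N b / N%:R.
    by near: N; apply: (cvgr_gt _ cvg_b); rewrite ltrBlDr ltrDl.
  by rewrite ltr_pdivlMr// mulrC => /ltW.
have big : 4 <= expR (c / 2 * N%:R).
  have : 4 / (c / 2) < N%:R by near: N; exact: nbhs_infty_gtr.
  rewrite ltr_pdivrMr// => h; have := expR_ge1Dx (c / 2 * N%:R); lra.
set a := N%:R * (b + m - eps).
have p0 : 0 <= gauss_peak R N by rewrite ltW// gauss_peak_gt0.
pose good := \sum_(s : Sigma N | ~~ (N%:R * eps < `|field_energy y N s - N%:R * m|))
   expR (b * field_energy y N s).
have good_ge : expR (N%:R * (psi - k)) / 2 <= good.
  have : expR (log_mgf y N b) <= 2 * expR (N%:R * (psi - c)) + good.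
    rewrite -sum_expR_field_energy.
    rewrite (bigID (fun s : Sigma N => N%:R * eps < `|field_energy y N s - N%:R * m|)) /=.
    by rewrite lerD2r.
  have : expR (N%:R * (psi - k)) <= expR (log_mgf y N b) by rewrite ler_expR.
  have : 4 * expR (N%:R * (psi - c)) <= expR (N%:R * (psi - k)).
    apply: (le_trans (ler_wpM2r (expR_ge0 _) big)).
    rewrite -expRD ler_expR; have : N%:R * k <= N%:R * (c / 2) by rewrite ler_pM2l.
    by lra.
  by lra.
have dens : gauss_peak R N * (expR (N%:R * (b ^+ 2 / 2) - b * a - N%:R * (2 * eps ^+ 2)) * good)
   <= intensity y N a.
  rewrite /intensity -mulr_sumr; apply: ler_wpM2l => //; rewrite mulr_sumr.
  rewrite big_mkcond; apply: ler_sum => s _; case: ifP => [|_]; last exact: expR_ge0.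
  rewrite -leNgt => hs; rewrite -expRD ler_expR (gauss_split R b)//.
  rewrite addrAC lerD2l lerN2 ler_pdivrMr ?mulr_gt0//.
  have : `|a - field_energy y N s - b * N%:R| <= 2 * (N%:R * eps).
    have -> : a - field_energy y N s - b * N%:R =
      - (field_energy y N s - N%:R * m) - N%:R * eps by rewrite /a; lra.
    have Ne : 0 <= N%:R * eps by rewrite mulr_ge0// ltW.
    by apply: (le_trans (ler_normB _ _)); rewrite normrN (ger0_norm Ne); lra.
  move=> /(fun h => ler_pM (normr_ge0 _) (normr_ge0 _) h h).
  rewrite -normrM -expr2 ger0_norm ?sqr_ge0// => /le_trans; apply.
  by lra.
have /le_trans /(_ dens) : gauss_peak R N *
    (expR (N%:R * (b ^+ 2 / 2) - b * a - N%:R * (2 * eps ^+ 2))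
    * (expR (N%:R * (psi - k)) / 2)) <= gauss_peak R N *
   (expR (N%:R * (b ^+ 2 / 2) - b * a - N%:R * (2 * eps ^+ 2)) * good).
  by apply: ler_wpM2l => //; apply: ler_wpM2l => //; exact: expR_ge0.
apply: lt_le_trans.
have : 2 < gauss_peak R N * expR (b * eps / 4 * N%:R).
  by near: N; apply: peak_exp_large; rewrite divr_gt0.
have : expR (b * eps / 4 * N%:R) <=
    expR (N%:R * (b ^+ 2 / 2) - b * a - N%:R * (2 * eps ^+ 2)) * expR (N%:R * (psi - k)).
  rewrite -expRD ler_expR.
  have : N%:R * k <= N%:R * (b * eps / 4) by rewrite ler_pM2l.
  have : N%:R * (eps * eps) <= N%:R * (eps * (b / 4)).
    by rewrite ler_pM2l// ler_pM2l// ltW.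
  by rewrite /a /psi expr2; lra.
move=> h1 h2; have := ler_wpM2l (ltW (gauss_peak_gt0 R N N0)) h1.
by lra.
Unshelve. all: by end_near. Qed.

Lemma cvg_level : level R y N / N%:R @[N --> \oo] --> b + m.
Proof.
have E0 : 0 < b + m by rewrite ltr_wpDr.
apply/cvgrPdist_le => e e0.
pose f := Num.min e (b / 8).
have f0 : 0 < f by rewrite lt_min e0 divr_gt0.
have fe : f <= e by rewrite /f ge_min lexx.
have fb : f <= b / 8 by rewrite /f ge_min lexx orbT.
near=> N.
have N0 : (0 < N)%N by near: N.
have N0' : 0 < N%:R :> R by rewrite ltr0n.
have up : level R y N <= N%:R * (b + m + f).
  apply: level_le => //; first by rewrite mulr_ge0// addr_ge0 ?ltW.
  have h : forall a, N%:R * (b + m + f) <= a -> intensity y N a <= 1.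
    by near: N; exact: intensity_le1_above.
  by move=> a /ltW; exact: h.
have low : N%:R * (b + m - f) <= level R y N.
  apply: level_ge => //; near: N; apply: intensity_gt1_below => //.
  by apply: (le_lt_trans fb); rewrite ltr_pM2l// ltf_pV2 ?posrE// ltr_nat.
rewrite distrC ler_distl; apply/andP; split.
  by rewrite ler_pdivlMr//; apply: le_trans low; rewrite mulrC ler_pM2l// lerD2l lerN2.
by rewrite ler_pdivrMr//; apply: (le_trans up); rewrite mulrC ler_pM2r// lerD2l.
Unshelve. all: by end_near. Qed.

Lemma level_gt0 : \forall N \near \oo, 0 < level R y N.
Proof.
near=> N.
have N0 : (0 < N)%N by near: N.
have N0' : 0 < N%:R :> R by rewrite ltr0n.
suff : 0 < level R y N / N%:R by rewrite pmulr_lgt0// invr_gt0.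
by near: N; apply: (cvgr_gt _ cvg_level); rewrite ltr_wpDr.
Unshelve. all: by end_near. Qed.

Lemma intensity_shift N (a z : R) : (0 < N)%N ->
  intensity y N (a + z) = \sum_(s : Sigma N)
    gauss_peak R N * expR (- (a - field_energy y N s) ^+ 2 / (2 * N%:R)) *
    expR (- (a - field_energy y N s) / N%:R * z - z ^+ 2 / (2 * N%:R)).
Proof.
move=> N0; apply: eq_bigr => s _; rewrite -mulrA -expRD; congr (_ * expR _).
by field; rewrite pnatr_eq0 -lt0n.
Qed.

Lemma norm_drift_le N (s : Sigma N) (a : R) : (0 < N)%N -> `|a / N%:R| <= b + m + 1 ->
  \sum_(i < N) `|y i| <= M * N%:R ->
  `|- (a - field_energy y N s) / N%:R| <= b + m + 1 + M.
Proof.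
move=> N0 ha hM; have N0' : 0 < N%:R :> R by rewrite ltr0n.
have -> : - (a - field_energy y N s) / N%:R = field_energy y N s / N%:R - a / N%:R by ring.
apply: (le_trans (ler_normB _ _)); rewrite addrC; apply: lerD => //.
rewrite normrM normfV (gtr0_norm N0') ler_pdivrMr//.
exact: le_trans (field_energy_le _ _ _ _) hM.
Qed.

Lemma level_normed_bound : \forall N \near \oo, `|level R y N / N%:R| <= b + m + 1.
Proof.
near=> N.
have N0' : 0 < N%:R :> R by rewrite ltr0n; near: N.
rewrite ger0_norm; last by rewrite divr_ge0// ltW//; near: N; exact: level_gt0.
by apply: ltW; near: N; apply: (cvgr_lt _ cvg_level); rewrite ltrDl.
Unshelve. all: by end_near. Qed.

(** The slopes (r - Y_N) / N are bounded, hence so is the rate at which the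
    intensity can grow; this is the dominating function used below. *)
Lemma intensity_level_bound : \forall N \near \oo, forall z,
  intensity y N (level R y N + z) <= expR ((b + m + 1 + M) * `|z|).
Proof.
near=> N => z.
have N0 : (0 < N)%N by near: N.
have N0' : 0 < N%:R :> R by rewrite ltr0n.
have l0 : 0 < level R y N by near: N; exact: level_gt0.
have lb : `|level R y N / N%:R| <= b + m + 1 by near: N; exact: level_normed_bound.
have hM : \sum_(i < N) `|y i| <= M * N%:R by near: N.
rewrite intensity_shift//.
have -> : expR ((b + m + 1 + M) * `|z|) =
    intensity y N (level R y N) * expR ((b + m + 1 + M) * `|z|).
  by rewrite intensity_level// mul1r.
rewrite mulr_suml; apply: ler_sum => s _.
apply: ler_wpM2l; first by rewrite mulr_ge0 ?expR_ge0// ltW// gauss_peak_gt0.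
rewrite ler_expR; apply: (@le_trans _ _ (- (level R y N - field_energy y N s) / N%:R * z)).
  by rewrite gerBl divr_ge0// sqr_ge0.
apply: (le_trans (ler_norm _)); rewrite normrM ler_wpM2r//.
exact: norm_drift_le.
Unshelve. all: by end_near. Qed.

(** An average, with the weights w(s), of exponentials whose exponents are
    within 2 delta |z| + z^2/(2N) of - b z, except on the configurations with
    |Y_N - N m| > N delta.  The latter have exponentially small weight: the
    weights are at most exp(N b^2/2 - b r) times the tilted ones, and this
    prefactor is exp(o(N)) against the tilted sum, because r / N -> b + m. *)
Lemma cvg_intensity_level (z : R) :
  intensity y N (level R y N + z) @[N --> \oo] --> expR (- b * z).
Proof.
apply/cvgrPdist_le => e e0.
pose A : R := (b + m + 1 + M + b) * `|z| + z ^+ 2.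
pose CA := expR (3 * A).
have CA0 : 0 < CA by exact: expR_gt0.
(* A bounds all exponents and CA is a Lipschitz constant of exp on [-A, A];
   with this delta the error terms proportional to delta are at most e / 4. *)
pose delta := e / (4 * CA * (`|z| + 1)).
have z1 : 0 < `|z| + 1 by rewrite ltr_wpDl.
have d0 : 0 < delta by rewrite divr_gt0// !mulr_gt0.
have hd : CA * (delta * `|z|) <= e / 4.
  have -> : CA * (delta * `|z|) = e / 4 * (`|z| / (`|z| + 1)).
    by rewrite /delta; field; rewrite !gt_eqF.
  have q1 : `|z| / (`|z| + 1) <= 1 by rewrite ler_pdivrMr// mul1r lerDl.
  by rewrite ler_piMr// divr_ge0// ltW.
have [c c0 conc] := energy_concentration delta d0.
near=> N.
have N0 : (0 < N)%N by near: N.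
have N1 : 1 <= N%:R :> R by rewrite ler1n.
have N0' : 0 < N%:R :> R by rewrite ltr0n.
have l0 : 0 < level R y N by near: N; exact: level_gt0.
have lb : `|level R y N / N%:R| <= b + m + 1 by near: N; exact: level_normed_bound.
have hM : \sum_(i < N) `|y i| <= M * N%:R by near: N.
have fconc : \sum_(s : Sigma N | N%:R * delta < `|field_energy y N s - N%:R * m|)
    expR (b * field_energy y N s) <= 2 * expR (N%:R * (psi - c)) by near: N.
have ud : `|b + m - level R y N / N%:R| <= delta.
  by near: N; exact: (cvgr_dist_le _ _ cvg_level _ d0).
have uc : b * (b + m - level R y N / N%:R) <= c / 2.
  have : `|b + m - level R y N / N%:R| <= c / (2 * b).
    by near: N; apply: (cvgr_dist_le _ _ cvg_level (c / (2 * b))); rewrite divr_gt0// mulr_gt0.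
  move=> /(le_trans (ler_norm _)); rewrite ler_pdivlMr ?mulr_gt0//; lra.
have Nz : CA * (z ^+ 2 / (2 * N%:R)) <= e / 4.
  have : 2 * CA * z ^+ 2 / e < N%:R by near: N; exact: nbhs_infty_gtr.
  rewrite ltr_pdivrMr// => h.
  by rewrite mulrA ler_pdivrMr ?mulr_gt0//; lra.
have Nexp : CA * (2 * A) * (2 * expR (- (c / 2) * N%:R)) <= e / 4.
  have : 16 * CA * `|A| / e / (c / 2) < N%:R by near: N; exact: nbhs_infty_gtr.
  have c2 : 0 < c / 2 by rewrite divr_gt0.
  rewrite ltr_pdivrMr// ltr_pdivrMr// => h.
  have := expR_ge1Dx (c / 2 * N%:R) => h'.
  have E0 := expR_gt0 (c / 2 * N%:R).
  rewrite mulNr expRN mulrA mulrA -[_ * _ * 2]mulrA ler_pdivrMr//.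
  have : CA * A <= CA * `|A| by rewrite ler_pM2l// ler_norm.
  have : e * (c / 2 * N%:R) <= e * expR (c / 2 * N%:R) by rewrite ler_pM2l//; lra.
  by lra.
set r := level R y N in l0 lb ud uc *.
pose w s := gauss_peak R N * expR (- (r - field_energy y N s) ^+ 2 / (2 * N%:R)).
have w0 s : 0 <= w s by rewrite mulr_ge0 ?expR_ge0// ltW// gauss_peak_gt0.
have w1 : \sum_(s : Sigma N) w s = 1 by exact: intensity_level.
have peak1 : gauss_peak R N <= 1.
  apply: (le_trans (gauss_peak_le R N N0)).
  by rewrite invf_le1 ?sqrtr_gt0// -[leLHS]sqrtr1 ler_wsqrtr.
pose far (s : Sigma N) := N%:R * delta < `|field_energy y N s - N%:R * m|.
have wfar : \sum_(s | far s) w s <= 2 * expR (- (c / 2) * N%:R).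
  apply: (@le_trans _ _ (expR (N%:R * (b ^+ 2 / 2) - b * r) * (2 * expR (N%:R * (psi - c))))).
    apply: le_trans (ler_wpM2l (expR_ge0 _) fconc); rewrite mulr_sumr.
    apply: ler_sum => s _; apply: le_trans (gauss_term_le R b r _ N N0).
    by rewrite ler_piMl// expR_ge0.
  rewrite mulrCA ler_pM2l// -expRD ler_expR.
  have -> : N%:R * (b ^+ 2 / 2) - b * r + N%:R * (psi - c) =
     N%:R * (b * (b + m - r / N%:R) - c) by rewrite /psi; field; rewrite gt_eqF.
  by rewrite mulrC ler_pM2r//; lra.
have M0 : 0 <= M.
  by rewrite -(pmulr_lge0 _ N0'); apply: le_trans hM; apply: sumr_ge0.
pose x s : R := - (r - field_energy y N s) / N%:R * z - z ^+ 2 / (2 * N%:R).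
have z20 : 0 <= z ^+ 2 by exact: sqr_ge0.
have zN : z ^+ 2 / (2 * N%:R) <= z ^+ 2.
  by rewrite ler_pdivrMr ?mulr_gt0// ler_peMr//; lra.
have zN0 : 0 <= z ^+ 2 / (2 * N%:R) by rewrite divr_ge0//; lra.
have az := normr_ge0 z.
have xA s : `|x s| <= A.
  apply: (le_trans (ler_normB _ _)); rewrite normrM (ger0_norm zN0) /A; apply: lerD => //.
  rewrite ler_wpM2r//; apply: (le_trans (norm_drift_le N s r N0 lb hM)).
  by rewrite lerDl ltW.
have bA : `|- b * z| <= A.
  rewrite normrM normrN (gtr0_norm b0) /A; apply: ler_wpDr => //.
  by apply: ler_wpM2r => //; move: b0 m0; lra.
have dx s : `|- b * z - x s| <= (if far s then 2 * A else 2 * delta * `|z| + z ^+ 2 / (2 * N%:R)).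
  case: ifPn => [_|]; first by apply: (le_trans (ler_normB _ _)); have := xA s; lra.
  rewrite /far -leNgt => near_s.
  have -> : - b * z - x s = z ^+ 2 / (2 * N%:R) +
      (- (b + m - r / N%:R) - (field_energy y N s - N%:R * m) / N%:R) * z.
    by rewrite /x; field; rewrite gt_eqF.
  apply: (le_trans (ler_normD _ _)); rewrite (ger0_norm zN0) addrC lerD2r normrM ler_wpM2r//.
  apply: (le_trans (ler_normB _ _)); rewrite normrN [leRHS]mulr_natl mulr2n; apply: lerD => //.
  by rewrite normrM normfV (gtr0_norm N0') ler_pdivrMr// [leRHS]mulrC.
rewrite intensity_shift//.
have -> : expR (- b * z) = \sum_s w s * expR (- b * z) by rewrite -mulr_suml w1 mul1r.
rewrite -sumrB.
apply: (le_trans (ler_norm_sum _ _ _)).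
apply: (@le_trans _ _ (\sum_s w s * (CA * (2 * delta * `|z| + z ^+ 2 / (2 * N%:R))) +
   \sum_(s | far s) w s * (CA * (2 * A)))).
  rewrite [X in _ <= _ + X]big_mkcond -big_split; apply: ler_sum => s _ /=.
  rewrite -/(w s) -/(x s) -mulrBr normrM (ger0_norm (w0 s)).
  have h : `|expR (- b * z) - expR (x s)| <= CA * `|- b * z - x s| by exact: expR_dist_le.
  have B0 : 0 <= CA * (2 * delta * `|z| + z ^+ 2 / (2 * N%:R)).
    apply: mulr_ge0; first exact: ltW.
    by apply: addr_ge0 => //; apply: mulr_ge0 => //; rewrite ltW// mulr_gt0.
  have := dx s; case: ifP => _ /(ler_wpM2l (ltW CA0)) /(le_trans h) /(ler_wpM2l (w0 s)) h2.
    by apply: (le_trans h2); rewrite lerDr mulr_ge0.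
  by rewrite addr0.
rewrite -!mulr_suml w1 mul1r.
have A0 : 0 <= A by apply: le_trans bA.
have : (\sum_(s | far s) w s) * (CA * (2 * A)) <= 2 * expR (- (c / 2) * N%:R) * (CA * (2 * A)).
  by apply: ler_wpM2r => //; rewrite !mulr_ge0// ltW.
by lra.
Unshelve. all: by end_near. Qed.

End asymptotics.

(** * A strong law of large numbers under exponential moments *)

Section strong_law.
Context d (T : measurableType d) (R : realType) (P : probability T R).

(** Markov's inequality and Borel-Cantelli. *)
Lemma ae_eventually_lt1 (h : nat -> T -> R) (rho : R) :
  (forall n, measurable_fun setT (h n)) -> (forall n w, 0 <= h n w) ->
  0 <= rho < 1 -> (forall n, \int[P]_w (h n w)%:E = (rho ^+ n)%:E)%E ->
  {ae P, forall w, \forall n \near \oo, h n w < 1}.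
Proof.
move=> mh h0 /andP[r0 r1] ih.
pose F n := [set w | 1 <= h n w].
have mF n : measurable (F n).
  rewrite [X in measurable X](_ : _ = setT `&` h n @^-1` `[1, +oo[%classic); first exact: mh.
  by rewrite setTI; apply/seteqP; split => w; rewrite /F /= in_itv/= andbT.
exists (lim_sup_set F); split.
- by apply: bigcapT_measurable => n; apply: bigcup_measurable.
- apply: lim_sup_set_cvg0 => //.
  apply: (@le_lt_trans _ _ (1 / (1 - rho))%:E); last exact: ltry.
  apply: lime_le; first exact: is_cvg_nneseries.
  apply: nearW => n; apply: (@le_trans _ _ (\sum_(0 <= i < n) (rho ^+ i)%:E)%E).
    apply: lee_sum => i _; rewrite -ih -(setIT (F i)) -integral_indic//.
    apply: ge0_le_integral => //.
    + exact/measurable_EFinP.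
    + exact/measurable_EFinP.
    + move=> w _; rewrite lee_fin indicE.
      by case: (boolP (w \in F i)) => [/set_mem//|_]; exact: h0.
  rewrite sumEFin lee_fin.
  have := @geometric_seriesE R 1 rho; rewrite lt_eqF// => /(_ isT).
  move=> /(congr1 (fun u : nat -> R => u n)); rewrite /series /=.
  under eq_bigr do rewrite mul1r.
  move=> ->; rewrite ler_pM2r ?invr_gt0 ?subr_gt0//.
  by rewrite mul1r gerBl exprn_ge0.
- move=> w /= nw; apply: contrapT => nF; apply: nw.
  have /existsNP [n nn] : ~ (forall n, (\bigcup_(j >= n) F j) w).
    by move=> h'; apply: nF => n _; exact: h'.
  exists n => // j /= nj; rewrite ltNge; apply/negP => hj; apply: nn.
  by exists j.
Qed.

Lemma expR_tilt_le (l x : R) : 0 <= l <= 1 ->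
  expR (l * x) <= 1 + l * x + l ^+ 2 * expR (3 * `|x|).
Proof.
move=> /andP[l0 l1]; apply: (le_trans (expR_le_quadratic _ _)).
rewrite lerD2l exprMn -mulrA ler_wpM2l ?sqr_ge0//.
have x1 : `|x| <= expR `|x| by apply: le_trans (expR_ge1Dx _); rewrite lerDr.
have x2 : x ^+ 2 <= expR (2 * `|x|).
  rewrite -real_normK ?num_real// expRM_natl ler_sqr ?nnegrE ?expR_ge0//.
have -> : 3 * `|x| = 2 * `|x| + `|x| by ring.
rewrite expRD; apply: ler_pM => //; first exact: sqr_ge0.
by rewrite ler_expR normrM (ger0_norm l0) ler_piMl.
Qed.

(** For small l the exponential moment of l Z is 1 + O(l^2), since Z is centred,
    which exp(- l eps) beats. *)
Lemma chernoff_rate (Z : T -> R) (eps : R) : measurable_fun setT Z ->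
  P.-integrable setT (EFin \o Z) -> \int[P]_w Z w = 0 ->
  P.-integrable setT (fun w => (expR (3 * `|Z w|))%:E) -> 0 < eps ->
  exists2 l : R, 0 < l & exists2 rho : R, 0 <= rho < 1 &
    (\int[P]_w (expR (l * (Z w - eps)))%:E = rho%:E)%E.
Proof.
move=> mZ iZ Z0 iE eps0.
pose K := \int[P]_w (expR (3 * `|Z w|)).
have K0 : 0 <= K by apply: Rintegral_ge0 => w _; exact: expR_ge0.
pose l := Num.min 1 (eps / (2 * (K + 1))).
have K1 : 0 < K + 1 by rewrite ltr_wpDl.
have l0 : 0 < l by rewrite lt_min ltr01 divr_gt0// mulr_gt0.
have l1 : l <= 1 by rewrite /l ge_min lexx.
have lK : l * (K + 1) <= eps / 2.
  have : l <= eps / (2 * (K + 1)) by rewrite /l ge_min lexx orbT.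
  by rewrite ler_pdivlMr ?mulr_gt0//; lra.
exists l => //.
pose bound w : R := 1 + l * Z w + l ^+ 2 * expR (3 * `|Z w|).
have ilZ : P.-integrable setT (EFin \o (fun w => l * Z w)).
  by apply: (integrableZl measurableT l iZ).
have ilE : P.-integrable setT (EFin \o (fun w => l ^+ 2 * expR (3 * `|Z w|))).
  by apply: (integrableZl measurableT (l ^+ 2) iE).
have i1 : P.-integrable setT (EFin \o (fun _ : T => 1 : R)).
  exact: finite_measure_integrable_cst.
have i1Z : P.-integrable setT (EFin \o (fun w => 1 + l * Z w)).
  exact: (integrableD measurableT i1 ilZ).
have ib : P.-integrable setT (EFin \o bound).
  exact: (integrableD measurableT i1Z ilE).
have ibE : \int[P]_w bound w = 1 + l ^+ 2 * K.
  rewrite /bound RintegralD// RintegralD// RintegralZl// RintegralZl// Z0 mulr0 addr0.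
  by rewrite Rintegral_cst//= probability_setT mul1r.
have mexp : measurable_fun setT (fun w => expR (l * (Z w - eps))).
  apply: measurableT_comp => //; apply: measurable_funM => //.
  exact: measurable_funB.
have le_b : (\int[P]_w (expR (l * (Z w - eps)))%:E <= (expR (- (l * eps)) * (1 + l ^+ 2 * K))%:E)%E.
  rewrite EFinM -ibE /Rintegral fineK ?integrable_fin_num//.
  rewrite -integralZl//; apply: ge0_le_integral => //.
  - exact/measurable_EFinP.
  - exact: measurable_int (integrableZl _ _ ib).
  - move=> w _; rewrite -EFinM lee_fin mulrBr expRD mulrC ler_wpM2l ?expR_ge0//.
    by apply: expR_tilt_le; rewrite ltW.
have ge0 : (0 <= \int[P]_w (expR (l * (Z w - eps)))%:E)%E.
  by apply: integral_ge0 => w _; rewrite lee_fin expR_ge0.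
have fin : (\int[P]_w (expR (l * (Z w - eps)))%:E)%E \is a fin_num.
  by rewrite ge0_fin_numE// (le_lt_trans le_b)// ltry.
exists (fine (\int[P]_w (expR (l * (Z w - eps)))%:E)%E); last by rewrite fineK.
rewrite fine_ge0//= -lte_fin fineK// (le_lt_trans le_b)// lte_fin.
apply: (@le_lt_trans _ _ (expR (- (l * eps)) * expR (l ^+ 2 * K))).
  by rewrite ler_wpM2l ?expR_ge0// expR_ge1Dx.
rewrite -expRD -[ltRHS]expR0 ltr_expR.
have : l * (l * (K + 1)) <= l * (eps / 2) by rewrite ler_pM2l.
have : 0 < l * eps by rewrite mulr_gt0.
have : 0 < l * l by rewrite mulr_gt0.
by rewrite expr2; lra.
Qed.

(** For each sign and each eps, the n-th Chernoff variable is a product of n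
    independent copies, so its expectation is the n-th power of the rate of
    [chernoff_rate]; hence it is eventually less than 1 almost surely. *)
Lemma ae_mean_cvg0 (X : nat -> {RV P >-> R}) (f : R -> R) :
  independent_family P (fun i => X i : T -> R) ->
  (forall i A, measurable A -> distribution P (X i) A = distribution P (X 0%N) A) ->
  measurable_fun setT f ->
  P.-integrable setT (EFin \o (f \o X 0%N)) -> \int[P]_w f (X 0%N w) = 0 ->
  P.-integrable setT (fun w => (expR (3 * `|f (X 0%N w)|))%:E) ->
  {ae P, forall w, (\sum_(i < n) f (X i w)) / n%:R @[n --> \oo] --> 0}.
Proof.
move=> Xind Xid mf fi f0 fe.
have side (e : bool) (k : nat) : {ae P, forall w, \forall n \near \oo,
    (-1) ^+ e * \sum_(i < n) f (X i w) <= n%:R * k.+1%:R^-1}.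
  have mfX i : measurable_fun setT (fun w => f (X i w)) by exact: measurableT_comp.
  have eps0 : 0 < k.+1%:R^-1 :> R by rewrite invr_gt0.
  have [||||l l0 [rho rho01 hrho]] :=
    @chernoff_rate (fun w => (-1) ^+ e * f (X 0%N w)) k.+1%:R^-1 _ _ _ _ eps0.
  - exact: measurable_funM.
  - exact: (integrableZl measurableT ((-1) ^+ e) fi).
  - by rewrite RintegralZl// f0 mulr0.
  - by under eq_fun do rewrite normrM normrX normrN1 expr1n mul1r.
  pose g (x : R) := expR (l * ((-1) ^+ e * f x - k.+1%:R^-1)).
  have mg : measurable_fun setT g.
    apply: measurableT_comp => //; apply: measurable_funM => //.
    by apply: measurable_funB => //; apply: measurable_funM.
  have mean_g i : (\int[P]_w (g (X i w))%:E = rho%:E)%E.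
    rewrite -hrho -(@ge0_integral_distribution _ _ _ _ _ P (X i) (EFin \o g)).
    + rewrite -[RHS](@ge0_integral_distribution _ _ _ _ _ P (X 0%N) (EFin \o g)).
      * by apply: eq_measure_integral => A mA _; exact: Xid.
      * exact/measurable_EFinP.
      * by move=> x; rewrite lee_fin expR_ge0.
    + exact/measurable_EFinP.
    + by move=> x; rewrite lee_fin expR_ge0.
  pose h n w : R := \prod_(i <- index_iota 0 n) g (X i w).
  have hE n w : h n w = expR (l * ((-1) ^+ e * \sum_(i < n) f (X i w) - n%:R * k.+1%:R^-1)).
    rewrite /h big_mkord -expR_sum; congr expR.
    rewrite -mulr_sumr; congr (_ * _); rewrite sumrB -mulr_sumr; congr (_ - _).
    by rewrite sumr_const card_ord mulr_natl.
  have /ae_eventually_lt1 : forall n, measurable_fun setT (h n).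
    by move=> n; apply: measurable_prod => i _; exact: measurableT_comp.
  move=> /(_ rho _ rho01) H; apply: filterS (H _ _).
  + move=> w; apply: filterS => n; rewrite hE -[ltRHS]expR0 ltr_expR.
    by rewrite pmulr_rlt0// subr_lt0 => /ltW.
  + by move=> n w; rewrite hE expR_ge0.
  + move=> n; rewrite /h (@expectation_prod_independent _ _ _ P _ X Xind
      (index_iota 0 n) (fun=> g) (fun=> rho)).
    * by rewrite big_const_seq count_predT size_iota subn0 -Monoid.iteropE.
    * exact: iota_uniq.
    * by [].
    * by move=> _ x; exact: expR_ge0.
    * by [].
have : {ae P, forall w, forall k, forall e : bool, \forall n \near \oo,
    (-1) ^+ e * \sum_(i < n) f (X i w) <= n%:R * k.+1%:R^-1}.
  apply: ae_foralln => k; apply: filterS2 (side true k) (side false k) => w h1 h2.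
  by case.
apply: filterS => w hw; apply/cvgrPdist_le => eps eps0.
pose k := Num.truncn (eps^-1).
have keps : k.+1%:R^-1 <= eps.
  by rewrite -[leRHS]invrK lef_pV2 ?posrE ?invr_gt0// ltW// truncnS_gt.
near=> n.
have n0 : 0 < n%:R :> R by rewrite ltr0n; near: n; exists 1%N.
have h1 : (-1) ^+ true * \sum_(i < n) f (X i w) <= n%:R * k.+1%:R^-1 by near: n; exact: hw.
have h2 : (-1) ^+ false * \sum_(i < n) f (X i w) <= n%:R * k.+1%:R^-1 by near: n; exact: hw.
rewrite sub0r normrN normrM normfV (gtr0_norm n0) ler_pdivrMr// ler_norml.
have h3 : n%:R * k.+1%:R^-1 <= eps * n%:R by rewrite mulrC ler_pM2r.
move: h1 h2; rewrite expr1 expr0 mul1r mulN1r => h1 h2.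
by apply/andP; split; [rewrite lerNl|]; exact: le_trans h3.
Unshelve. all: by end_near. Qed.

End strong_law.

(** * Averages of ln cosh over the field *)

Section field_averages.
Context d (T : measurableType d) (R : realType) (P : probability T R).
Variable X : {RV P >-> R}.
Hypothesis X_mgf : forall t : R, ('M_P X t < +oo)%E.

Lemma integrable_expR_norm (c : R) :
  P.-integrable setT (fun w => (expR (c * `|X w|))%:E).
Proof.
have iX t : P.-integrable setT (fun w => (expR (t * X w))%:E).
  apply/integrableP; split.
    by apply/measurable_EFinP; apply: measurableT_comp => //; apply: measurable_funM.
  have := X_mgf t; rewrite /mmt_gen_fun unlock; apply: le_lt_trans.
  rewrite le_eqVlt; apply/orP; left; apply/eqP; apply: eq_integral => w _ /=.
  by rewrite ger0_norm ?expR_ge0// mulrC.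
apply: (@le_integrable _ _ _ _ _ measurableT _
  (fun w => (expR (c * X w))%:E + (expR (- c * X w))%:E)%E) => //.
- apply/measurable_EFinP; apply: measurableT_comp => //; apply: measurable_funM => //.
  exact: measurableT_comp.
- move=> w _; rewrite -EFinD !abse_EFin lee_fin (ger0_norm (expR_ge0 _)).
  rewrite (ger0_norm (addr_ge0 (expR_ge0 _) (expR_ge0 _))).
  have [x0|x0] := leP 0 (X w).
    by rewrite (ger0_norm x0) lerDl expR_ge0.
  by rewrite (ltr0_norm x0) mulrN mulNr lerDr expR_ge0.
- exact: integrableD.
Qed.

Lemma integrable_dominated_expR (f : T -> R) (c : R) : measurable_fun setT f ->
  (forall w, `|f w| <= expR (c * `|X w|)) -> P.-integrable setT (EFin \o f).
Proof.
move=> mf hf; apply: le_integrable (integrable_expR_norm c) => //.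
  exact/measurable_EFinP.
by move=> w _ /=; rewrite lee_fin [leRHS](ger0_norm (expR_ge0 _)).
Qed.

Lemma measurable_lncosh (t : R) : measurable_fun setT (fun x : R => ln (cosh (t * x))).
Proof.
apply: measurableT_comp => //; apply: measurable_funM => //.
by apply: measurable_funD; apply: measurableT_comp => //;
  do ?[apply: measurableT_comp => //]; apply: measurable_funM.
Qed.

Lemma integrable_lncosh (t : R) :
  P.-integrable setT (EFin \o (fun w => ln (cosh (t * X w)))).
Proof.
apply: (@integrable_dominated_expR _ `|t|).
  exact: (measurableT_comp (measurable_lncosh t)).
move=> w; apply: (le_trans (norm_lncosh_le _ _)).
by rewrite normrM; apply: le_trans (expR_ge1Dx _); rewrite lerDr.
Qed.

Definition mean_lncosh (t : R) : R := \int[P]_w ln (cosh (t * X w)).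

Lemma measurable_mul_tanh (b : R) : measurable_fun setT (fun x : R => x * tanh (b * x)).
Proof.
under eq_fun do rewrite tanhE.
apply: measurable_funM => //; apply: measurable_funM.
  apply: measurable_funM => //.
  by apply: measurable_funB; apply: measurableT_comp => //;
    do ?[apply: measurableT_comp => //]; apply: measurable_funM.
apply: measurableT_comp => //; apply: measurableT_comp => //.
exact: measurable_lncosh.
Qed.

Lemma integrable_mul_tanh (b : R) :
  P.-integrable setT (EFin \o (fun w => X w * tanh (b * X w))).
Proof.
apply: (@integrable_dominated_expR _ 1).
  exact: (measurableT_comp (measurable_mul_tanh b)).
move=> w; rewrite normrM mul1r.
apply: (@le_trans _ _ (`|X w| * 1)); first by rewrite ler_wpM2l//; exact: norm_tanh_le1.
by rewrite mulr1; apply: le_trans (expR_ge1Dx _); rewrite lerDr.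
Qed.

Lemma mean_tanhE (b : R) : mean_tanh P X b = \int[P]_w (X w * tanh (b * X w)).
Proof. by rewrite /mean_tanh unlock. Qed.

Lemma mean_log_coshE (b : R) : mean_log_cosh P X b = mean_lncosh b.
Proof. by rewrite /mean_log_cosh unlock. Qed.

Lemma mean_tanh_ge0 (b : R) : 0 <= b -> 0 <= mean_tanh P X b.
Proof.
move=> b0; rewrite mean_tanhE; apply: Rintegral_ge0 => w _.
have -> : X w * tanh (b * X w) =
    X w * (expR (b * X w) - expR (- (b * X w))) / 2 / cosh (b * X w).
  by rewrite /tanh /sinh !mulrA.
apply: divr_ge0; last exact: ltW (cosh_gt0 _ _).
apply: divr_ge0 => //.
have [x0|x0] := leP 0 (X w).
  apply: mulr_ge0 => //; rewrite subr_ge0 ler_expR.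
  by have := mulr_ge0 b0 x0; lra.
apply: mulr_le0; first exact: ltW.
rewrite subr_le0 ler_expR.
by have := mulr_ge0_le0 b0 (ltW x0); lra.
Qed.

(** Identifies m as the slope of t |-> E(ln cosh(t h)) at b, with a quadratic
    error, by integrating [lncosh_add_le]. *)
Lemma mean_lncosh_add_le (b t : R) : `|t| <= 1 ->
  mean_lncosh (b + t) <= mean_lncosh b + t * mean_tanh P X b
    + \int[P]_w expR (3 * `|X w|) * t ^+ 2.
Proof.
move=> t1; rewrite mean_tanhE /mean_lncosh.
have iE := integrable_expR_norm 3.
have iT := integrable_mul_tanh b.
have itT : P.-integrable setT (EFin \o (fun w => t * (X w * tanh (b * X w)))).
  exact: (integrableZl measurableT t iT).
have iEt : P.-integrable setT (EFin \o (fun w => expR (3 * `|X w|) * t ^+ 2)).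
  exact: (integrableZr measurableT (t ^+ 2) iE).
have i12 : P.-integrable setT (EFin \o (fun w => ln (cosh (b * X w)) + t * (X w * tanh (b * X w)))).
  exact: (integrableD measurableT (integrable_lncosh b) itT).
rewrite -RintegralZl// -RintegralZr// -RintegralD//; last exact: integrable_lncosh.
rewrite -RintegralD//; apply: le_Rintegral => //; first exact: integrable_lncosh.
  exact: (integrableD measurableT i12 iEt).
move=> w _; rewrite mulrDl; apply: (le_trans (lncosh_add_le _ _ _)).
rewrite -[t * X w * _]mulrA lerD2l exprMn -mulrA mulrC.
apply: ler_wpM2r; first exact: sqr_ge0.
have x1 : `|X w| <= expR `|X w| by apply: le_trans (expR_ge1Dx _); rewrite lerDr.
have x2 : X w ^+ 2 <= expR (2 * `|X w|).
  by rewrite -real_normK ?num_real// expRM_natl ler_sqr ?nnegrE ?expR_ge0.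
have -> : 3 * `|X w| = 2 * `|X w| + `|X w| by ring.
rewrite expRD; apply: ler_pM => //; first exact: sqr_ge0.
by rewrite ler_expR normrM ler_piMl.
Qed.

End field_averages.

Arguments mean_lncosh {d T R} P X t.

Section field_strong_law.
Context d (T : measurableType d) (R : realType) (P : probability T R).
Variable h : nat -> {RV P >-> R}.
Hypothesis h_indep : independent_family P (fun i : nat => h i : T -> R).
Hypothesis h_ident : forall (i : nat) (A : set R), measurable A ->
  distribution P (h i) A = distribution P (h 0%N) A.
Hypothesis h_mgf : forall t : R, ('M_P (h 0%N) t < +oo)%E.

Lemma ae_mean_lncosh (t : R) : {ae P, forall w,
  (\sum_(i < n) ln (cosh (t * h i w))) / n%:R @[n --> \oo] --> mean_lncosh P (h 0%N) t}.
Proof.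
set L := mean_lncosh _ _ _.
have mf : measurable_fun setT (fun x : R => ln (cosh (t * x)) - L).
  by apply: measurable_funB => //; exact: measurable_lncosh.
have iL : P.-integrable setT (EFin \o (fun _ : T => L)).
  exact: finite_measure_integrable_cst.
have il := integrable_lncosh d T R P (h 0%N) h_mgf t.
have := @ae_mean_cvg0 _ _ _ P h (fun x => ln (cosh (t * x)) - L) h_indep h_ident mf.
move=> H; apply: filterS (H _ _ _).
- move=> w hw; have : (\sum_(i < n) (ln (cosh (t * h i w)) - L)) / n%:R + L @[n --> \oo] --> 0 + L.
    by apply: cvgD => //; exact: cvg_cst.
  rewrite add0r; apply: cvg_trans; apply: near_eq_cvg; near=> n.
  rewrite sumrB sumr_const card_ord -[L *+ n]mulr_natr mulrBl mulfK ?subrK//.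
  by rewrite pnatr_eq0 -lt0n; near: n; exists 1%N.
- exact: (integrableB measurableT il iL).
- by rewrite RintegralB// Rintegral_cst//= probability_setT mulr1 subrr.
- apply: (@le_integrable _ _ _ _ _ measurableT _
    (fun w => (expR (3 * `|L|))%:E * (expR (3 * `|t| * `|h 0%N w|))%:E)%E) => //.
  + apply/measurable_EFinP; apply: measurableT_comp => //; apply: measurable_funM => //.
    apply: measurableT_comp => //; exact: (measurableT_comp mf).
  + move=> w _; rewrite -EFinM !abse_EFin lee_fin (ger0_norm (expR_ge0 _)).
    rewrite (ger0_norm (mulr_ge0 (expR_ge0 _) (expR_ge0 _))).
    rewrite -expRD ler_expR -mulrA -mulrDr ler_pM2l//.
    apply: (le_trans (ler_normB _ _)); rewrite addrC lerD2l -normrM.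
    exact: norm_lncosh_le.
  + by apply: integrableZl => //; exact: integrable_expR_norm.
Unshelve. all: by end_near. Qed.

End field_strong_law.

(** b = 0 would give 0 = sqrt(2 ln 2).  So b > 0, the argument of the square
    root is positive, and the equation can be squared. *)
Lemma self_consistentP d (T : measurableType d) (R : realType) (P : probability T R)
    (X : T -> R) (b : R) : self_consistent P X b ->
  0 < b /\ ln 2 + mean_log_cosh P X b = b ^+ 2 / 2 + b * mean_tanh P X b.
Proof.
move=> bE; have b0 : 0 <= b by rewrite bE sqrtr_ge0.
have b_neq0 : b != 0.
  apply/eqP => b0'; move: bE; rewrite /self_consistent b0' mul0r sub0r opprK.
  have -> : mean_log_cosh P X 0 = 0.
    rewrite /mean_log_cosh unlock integral0_eq// => w _.
    by rewrite mul0r /cosh oppr0 expR0 -[1 + 1]/(2%:R) divff// ln1.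
  rewrite addr0 => /esym/eqP; rewrite sqrtr_eq0 leNgt => /negP; apply.
  by rewrite mulr_gt0// ln_gt0// ltr1n.
have bp : 0 < b by rewrite lt_def b_neq0.
split => //; move: bp; rewrite {1}bE sqrtr_gt0 => pos.
have := congr1 (fun x => x ^+ 2) bE; rewrite sqr_sqrtr ?ltW// => ->.
by lra.
Qed.

Section typical_field.
Context d (T : measurableType d) (R : realType) (P : probability T R).
Variable h : nat -> {RV P >-> R}.
Variable b : R.
Hypothesis h_indep : independent_family P (fun i : nat => h i : T -> R).
Hypothesis h_ident : forall (i : nat) (A : set R), measurable A ->
  distribution P (h i) A = distribution P (h 0%N) A.
Hypothesis h_mgf : forall t : R, ('M_P (h 0%N) t < +oo)%E.
Hypothesis bE : self_consistent P (h 0%N) b.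

Lemma ae_cvg_log_mgf (t : R) : {ae P, forall w,
  log_mgf (fun i => h i w) N t / N%:R @[N --> \oo] --> ln 2 + mean_lncosh P (h 0%N) t}.
Proof.
apply: filterS (ae_mean_lncosh d T R P h h_indep h_ident h_mgf t) => w hw.
have : ln 2 + (\sum_(i < n) ln (cosh (t * h i w))) / n%:R @[n --> \oo]
    --> ln 2 + mean_lncosh P (h 0%N) t by apply: cvgD => //; exact: cvg_cst.
apply: cvg_trans; apply: near_eq_cvg; near=> n.
have n0 : n%:R != 0 :> R by rewrite pnatr_eq0 -lt0n; near: n; exists 1%N.
by rewrite /log_mgf mulrDl mulrAC mulfV// mul1r.
Unshelve. all: by end_near. Qed.

(** Only countably many values of t are involved: b, b +- 1/(n+1), and 1.  The
    last one controls the averages of |h|, because |x| <= ln cosh x + ln 2. *)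
Lemma ae_level_intensity : {ae P, forall w,
  [/\ level R (fun i => h i w) N / N%:R @[N --> \oo] --> E_max P (h 0%N) b,
      forall z, intensity (fun i => h i w) N (level R (fun i => h i w) N + z) @[N --> \oo]
        --> expR (- b * z)
    & exists A, \forall N \near \oo, forall z,
        intensity (fun i => h i w) N (level R (fun i => h i w) N + z) <= expR (A * `|z|)]}.
Proof.
have [b0 Hb] := self_consistentP _ _ _ _ _ _ bE.
have m0 := mean_tanh_ge0 d T R P (h 0%N) b (ltW b0).
set m := mean_tanh P (h 0%N) b in Hb m0.
pose K := \int[P]_w expR (3 * `|h 0%N w|).
have shifts : {ae P, forall w, forall n (e : bool),
    log_mgf (fun i => h i w) N (b + (-1) ^+ e * n.+1%:R^-1) / N%:R @[N --> \oo]
      --> ln 2 + mean_lncosh P (h 0%N) (b + (-1) ^+ e * n.+1%:R^-1)}.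
  apply: ae_foralln => n.
  apply: filterS2 (ae_cvg_log_mgf (b + (-1) ^+ true * n.+1%:R^-1))
    (ae_cvg_log_mgf (b + (-1) ^+ false * n.+1%:R^-1)) => w h1 h2.
  by case.
apply: filterS3 (ae_cvg_log_mgf b) shifts
  (ae_mean_lncosh d T R P h h_indep h_ident h_mgf 1) => w hb hs h1.
have hb' : log_mgf (fun i => h i w) N b / N%:R @[N --> \oo] --> b ^+ 2 / 2 + b * m.
  by rewrite -Hb mean_log_coshE.
have hs' (e : bool) (n : nat) : exists2 L : R,
    L <= b ^+ 2 / 2 + b * m + (-1) ^+ e * n.+1%:R^-1 * m + K * n.+1%:R^-1 ^+ 2 &
    log_mgf (fun i => h i w) N (b + (-1) ^+ e * n.+1%:R^-1) / N%:R @[N --> \oo] --> L.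
  exists (ln 2 + mean_lncosh P (h 0%N) (b + (-1) ^+ e * n.+1%:R^-1)); last exact: hs.
  rewrite -Hb mean_log_coshE -!addrA lerD2l.
  apply: (le_trans (mean_lncosh_add_le d T R P (h 0%N) h_mgf b _ _)).
    by rewrite normrM normrX normrN1 expr1n mul1r ger0_norm// invf_le1// ler1n.
  by rewrite -addrA lerD2l lerD2l exprMn sqrr_sign mul1r.
pose M := mean_lncosh P (h 0%N) 1 + 1 + ln 2.
have hM : \forall N \near \oo, \sum_(i < N) `|h i w| <= M * N%:R.
  near=> N; have N0 : 0 < N%:R :> R by rewrite ltr0n; near: N; exists 1%N.
  apply: (@le_trans _ _ (\sum_(i < N) (ln (cosh (1 * h i w)) + ln 2))).
    by apply: ler_sum => i _; rewrite mul1r normr_le_lncosh.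
  rewrite big_split /= sumr_const card_ord -[ln 2 *+ N]mulr_natr [leRHS]mulrDl lerD2r.
  rewrite -ler_pdivrMr//; apply: ltW; near: N.
  by apply: (cvgr_lt _ h1); rewrite ltrDl.
split.
- by apply: (@cvg_level R _ b m K) => //.
- by move=> z; apply: (@cvg_intensity_level R _ b m K M) => //.
- exists (b + m + 1 + M); by apply: (@intensity_level_bound R _ b m K M) => //.
Unshelve. all: by end_near. Qed.

End typical_field.

(** * Laplace functionals of many small contributions *)

(** The lower bound is 1/(1 - a) = 1 + a/(1 - a) <= exp(a/(1 - delta)). *)
Lemma prod_1B_bounds (R : realType) (I : finType) (a : I -> R) (delta : R) :
  (forall i, 0 <= a i) -> (forall i, a i <= delta) -> delta < 1 ->
  expR (- ((\sum_i a i) / (1 - delta))) <= \prod_i (1 - a i) <= expR (- \sum_i a i).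
Proof.
move=> a0 ad d1; apply/andP; split.
  rewrite mulr_suml -sumrN expR_sum; apply: ler_prod => i _.
  rewrite expR_ge0/=; have da := ad i; have ai := a0 i.
  have p : 0 < 1 - a i by lra.
  rewrite expRN -[leRHS]invrK lef_pV2 ?posrE ?invr_gt0 ?expR_gt0//.
  apply: (@le_trans _ _ (1 + a i / (1 - a i))).
    by rewrite le_eqVlt; apply/orP; left; apply/eqP; field; rewrite gt_eqF.
  apply: (le_trans (expR_ge1Dx _)); rewrite ler_expR ler_wpM2l//.
  by rewrite lef_pV2 ?posrE; lra.
rewrite -sumrN expR_sum; apply: ler_prod => i _.
rewrite expR_ge1Dx andbT subr_ge0; apply: le_trans (ad i) _; exact: ltW.
Qed.

Lemma cvg_prod_1B (R : realType) (I : nat -> finType) (a : forall N, I N -> R)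
    (delta : nat -> R) (l : R) :
  (\forall N \near \oo, forall i, 0 <= a N i <= delta N) ->
  delta N @[N --> \oo] --> 0 -> \sum_i a N i @[N --> \oo] --> l ->
  \prod_i (1 - a N i) @[N --> \oo] --> expR (- l).
Proof.
move=> ha hd hs.
apply: (@squeeze_cvgr _ _ _ _ (fun N => expR (- ((\sum_i a N i) / (1 - delta N))))
  (fun N => expR (- \sum_i a N i))).
- near=> N.
  have h : forall i, 0 <= a N i <= delta N by near: N.
  apply: prod_1B_bounds; first by move=> i; have /andP[] := h i.
    by move=> i; have /andP[] := h i.
  by near: N; exact: (cvgr_lt _ hd).
- apply: continuous_cvg; first exact: continuous_expR.
  apply: cvgN; have -> : l = l / (1 - 0) by rewrite subr0 divr1.
  apply: cvgM => //; apply: cvgV; first by rewrite subr0 oner_eq0.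
  by apply: cvgB => //; exact: cvg_cst.
- apply: continuous_cvg; first exact: continuous_expR.
  exact: cvgN.
Unshelve. all: by end_near. Qed.

Lemma integral_shift (R : realType) (G : R -> R) (c : R) : continuous G -> (forall z, 0 <= G z) ->
  (\int[lebesgue_measure]_z (G z)%:E = \int[lebesgue_measure]_x (G (x + c))%:E)%E.
Proof.
move=> cG G0.
have dF : (fun x : R => x + c)^`()%classic = cst 1.
  by apply/funext => x; rewrite derive1E deriveD// derive_id derive_cst addr0.
rewrite (@increasing_ge0_integration_by_substitutionT _ (fun x : R => x + c))//.
- by apply: eq_integral => x _; rewrite dF /= mulr1.
- by move=> x y xy; rewrite ltrD2r.
- by rewrite dF => x; exact: cvg_cst.
- by rewrite dF; exact: is_cvg_cst.
- by rewrite dF; exact: is_cvg_cst.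
- exact: cvg_addrr_Ny.
- exact: cvg_addrr.
Qed.

Section test_functions.
Variables (R : realType) (phi : R -> R).
Hypothesis tphi : test_function phi.
Local Notation mu := lebesgue_measure.

Definition laplace_gap (z : R) : R := 1 - expR (- phi z).

Lemma laplace_gap_ge0 z : 0 <= laplace_gap z.
Proof.
have [_ phi0 _] := tphi.
by rewrite subr_ge0 -[leRHS]expR0 ler_expR oppr_le0.
Qed.

Lemma laplace_gap_le1 z : laplace_gap z <= 1.
Proof. by rewrite gerBl expR_ge0. Qed.

Lemma continuous_laplace_gap : continuous laplace_gap.
Proof.
have [cphi _ _] := tphi; move=> z.
have cN : continuous (fun z => - phi z) by move=> u; apply: cvgN; exact: cphi.
have h : expR (- phi u) @[u --> z] --> expR (- phi z).
  exact: (continuous_comp (cN z) (@continuous_expR R _)).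
by apply: cvgB h; exact: cvg_cst.
Qed.

Lemma measurable_laplace_gap : measurable_fun setT laplace_gap.
Proof. exact: continuous_measurable_fun continuous_laplace_gap. Qed.

Lemma laplace_gap_support : exists2 D : R, 0 < D & forall z, D < `|z| -> laplace_gap z = 0.
Proof.
have [_ _ /compact_bounded [M [_ hM]]] := tphi.
exists (`|M| + 1) => [|z zM]; first by rewrite ltr_wpDl.
apply: contrapT => gz.
have : closure [set x | phi x != 0] z.
  apply: subset_closure => /=; apply/eqP => phi0; apply: gz.
  by rewrite /laplace_gap phi0 oppr0 expR0 subrr.
have M1 : M < `|M| + 1 by rewrite (le_lt_trans (ler_norm M))// ltrDl.
by move=> /(hM _ M1) /=; rewrite leNgt zM.
Qed.

Lemma integrable_laplace_gap_mul (g : R -> R) : measurable_fun setT g ->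
  (forall D : R, exists B : R, forall z : R, `|z| <= D -> `|g z| <= B) ->
  mu.-integrable [set: R] (EFin \o (fun z => laplace_gap z * g z)).
Proof.
move=> mg gB; have [D D0 hD] := laplace_gap_support; have [B hB] := gB D.
have B0 : 0 <= B by apply: le_trans (hB 0 _); rewrite ?normr0// ltW.
have iI : mu.-integrable [set: R] (EFin \o (fun z => B * \1_(`[- D, D]%classic : set R) z)).
  have i0 := @integrable_indic_itv R (- D) D true false.
  exact: (integrableZl measurableT B i0).
apply: le_integrable iI => //.
  by apply/measurable_EFinP; apply: measurable_funM => //; exact: measurable_laplace_gap.
move=> z _ /=; rewrite lee_fin [leRHS]ger0_norm ?mulr_ge0// normrM (ger0_norm (laplace_gap_ge0 z)).
have [zD|zD] := leP `|z| D; last by rewrite hD// mul0r mulr_ge0.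
rewrite indicE mem_set ?mulr1; last by rewrite /= in_itv/= -ler_norml.
apply: (@le_trans _ _ (1 * B)); last by rewrite mul1r.
by apply: ler_pM => //; [exact: laplace_gap_ge0|exact: laplace_gap_le1|exact: hB].
Qed.

Lemma integrable_laplace_gap : mu.-integrable [set: R] (EFin \o laplace_gap).
Proof.
have := @integrable_laplace_gap_mul (cst 1) _ _.
rewrite (_ : (fun z => laplace_gap z * cst 1 z) = laplace_gap); last first.
  by apply/funext => z; rewrite mulr1.
by apply => //; move=> D; exists 1 => z _; rewrite normr1.
Qed.

(** The expectation of 1 - exp(- phi(X + Y_N(s) - r)) for a centred Gaussian X of
    variance N, written in the variable z = x + Y_N(s) - r. *)
Definition gauss_gap (y : nat -> R) N (r : R) (s : Sigma N) : R :=
  \int[mu]_z (laplace_gap z *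
    (gauss_peak R N * expR (- (r + z - field_energy y N s) ^+ 2 / (2 * N%:R)))).

Lemma measurable_shifted_gauss N (c : R) : measurable_fun [set: R]
  (fun z => gauss_peak R N * expR (- (c + z) ^+ 2 / (2 * N%:R))).
Proof.
apply: measurable_funM => //; apply: measurableT_comp => //; apply: measurable_funM => //.
apply: measurableT_comp => //; apply: measurable_funX.
exact: measurable_funD.
Qed.

Lemma gauss_peak_expR_le N (u : R) : (0 < N)%N ->
  `|gauss_peak R N * expR (- u ^+ 2 / (2 * N%:R))| <= gauss_peak R N.
Proof.
move=> N0; have p := gauss_peak_gt0 R N N0.
rewrite (ger0_norm (mulr_ge0 (ltW p) (expR_ge0 _))).
rewrite -[leRHS]mulr1 ler_pM2l// -[leRHS]expR0 ler_expR mulNr oppr_le0.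
by rewrite divr_ge0// sqr_ge0.
Qed.

Lemma integrable_gauss_gap (y : nat -> R) N (r : R) (s : Sigma N) : (0 < N)%N ->
  mu.-integrable [set: R] (EFin \o (fun z => laplace_gap z *
    (gauss_peak R N * expR (- (r + z - field_energy y N s) ^+ 2 / (2 * N%:R))))).
Proof.
move=> N0; apply: integrable_laplace_gap_mul.
  under eq_fun do rewrite addrAC; exact: measurable_shifted_gauss.
by move=> D; exists (gauss_peak R N) => z _; exact: gauss_peak_expR_le.
Qed.

Lemma gauss_gap_bounds (y : nat -> R) N (r : R) (s : Sigma N) : (0 < N)%N ->
  0 <= gauss_gap y N r s <= gauss_peak R N * \int[mu]_z laplace_gap z.
Proof.
move=> N0; have p := gauss_peak_gt0 R N N0; apply/andP; split.
  apply: Rintegral_ge0 => z _; apply: mulr_ge0; first exact: laplace_gap_ge0.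
  by rewrite mulr_ge0 ?expR_ge0// ltW.
rewrite -RintegralZl//; last exact: integrable_laplace_gap.
apply: le_Rintegral => //; first exact: integrable_gauss_gap.
  by apply: (integrableZl measurableT (gauss_peak R N) integrable_laplace_gap).
move=> z _; rewrite mulrC ler_wpM2r ?laplace_gap_ge0//.
by apply: le_trans (ler_norm _) _; exact: gauss_peak_expR_le.
Qed.

Lemma sum_gauss_gap (y : nat -> R) N (r : R) : (0 < N)%N ->
  ((\sum_(s : Sigma N) gauss_gap y N r s)%:E =
   \int[mu]_z (laplace_gap z * intensity y N (r + z))%:E)%E.
Proof.
move=> N0; rewrite -sumEFin.
under eq_bigr => s _.
  rewrite /gauss_gap /Rintegral fineK; last first.
    exact: (integrable_fin_num measurableT (integrable_gauss_gap y N r s N0)).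
  over.
rewrite -ge0_integral_sum//.
- by apply: eq_integral => z _; rewrite sumEFin -mulr_sumr.
- by move=> s; exact: measurable_int (integrable_gauss_gap y N r s N0).
- move=> s z _; rewrite lee_fin; apply: mulr_ge0; first exact: laplace_gap_ge0.
  by rewrite mulr_ge0 ?expR_ge0// ltW// gauss_peak_gt0.
Qed.

Lemma expectation_expR_shift d (T : measurableType d) (P : probability T R)
    (X : {RV P >-> R}) (y : nat -> R) N (r : R) (s : Sigma N) : (0 < N)%N ->
  (forall A, measurable A -> distribution P X A = normal_prob 0 (Num.sqrt (N%:R : R)) A) ->
  (\int[P]_w (expR (- phi (X w + field_energy y N s - r)))%:E = (1 - gauss_gap y N r s)%:E)%E.
Proof.
move=> N0 XN; set Y := field_energy y N s.
pose pdf := normal_pdf (0 : R) (Num.sqrt N%:R).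
have mpdf : measurable_fun [set: R] pdf by exact: measurable_normal_pdf.
have pdf0 x : 0 <= pdf x by exact: normal_pdf_ge0.
have mshift : measurable_fun [set: R] (fun x : R => x + Y - r).
  by apply: measurable_funB => //; apply: measurable_funD.
have mgap : measurable_fun [set: R] (fun x => laplace_gap (x + Y - r)).
  exact: (measurableT_comp measurable_laplace_gap).
pose g x := expR (- phi (x + Y - r)).
have gE x : g x = 1 - laplace_gap (x + Y - r) by rewrite /laplace_gap opprB addrC subrK.
have mg : measurable_fun [set: R] g.
  rewrite (_ : g = fun x => 1 - laplace_gap (x + Y - r)); last exact/funext.
  exact: measurable_funB.
have g0 x : 0 <= g x by exact: expR_ge0.
rewrite -(@ge0_integral_distribution _ _ _ _ _ P X (EFin \o g)); last 2 first.
- exact/measurable_EFinP.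
- by move=> x; rewrite lee_fin.
have := @ge0_integral_reweight _ _ _ _ R lebesgue_measure (distribution P X) id pdf 1.
move=> /(_ (@measurable_id _ _ _) mpdf pdf0 ler01) H.
have := H _ g mg g0; rewrite mul1e => <-; last by move=> B mB; rewrite mul1e [RHS]XN.
have ipdf : mu.-integrable [set: R] (EFin \o pdf) by exact: integrable_normal_pdf.
have igap : mu.-integrable [set: R] (EFin \o (fun x => pdf x * laplace_gap (x + Y - r))).
  apply: le_integrable ipdf => //.
    by apply/measurable_EFinP; exact: measurable_funM.
  move=> x _ /=; rewrite lee_fin normrM ler_piMr//.
  by rewrite ger0_norm ?laplace_gap_ge0// laplace_gap_le1.
transitivity (\int[mu]_x (pdf x - pdf x * laplace_gap (x + Y - r)))%:E.
  rewrite /Rintegral fineK; last first.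
    exact: (integrable_fin_num measurableT (integrableB measurableT ipdf igap)).
  by apply: eq_integral => x _; rewrite gE mulrBr mulr1.
rewrite RintegralB//; congr (_ - _)%:E.
  by rewrite /Rintegral integral_normal_pdf.
rewrite /gauss_gap /Rintegral; congr fine.
rewrite [RHS](@integral_shift _ _ (Y - r)).
- apply: eq_integral => x _; congr (_%:E).
  rewrite /pdf gauss_peak_normal_pdf// mulrC; congr (_ * (_ * expR (- _ ^+ 2 / _))).
    by congr laplace_gap; rewrite addrA.
  by rewrite -/Y; ring.
- move=> z; apply: cvgM; first exact: continuous_laplace_gap.
  exact: (continuous_comp (continuousD (cvg_cst r) (cvg_id)) (continuous_gauss R N Y _)).
- move=> z; apply: mulr_ge0; first exact: laplace_gap_ge0.
  by rewrite mulr_ge0 ?expR_ge0// ltW// gauss_peak_gt0.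
Qed.

End test_functions.

Section poisson_limit.
Variables (R : realType) (phi : R -> R).
Hypothesis tphi : test_function phi.
Local Notation mu := lebesgue_measure.

(** Dominated convergence.  The bound holds only for large N, hence the shift of
    the sequence by N0. *)
Lemma cvg_sum_gauss_gap (y : nat -> R) (r : nat -> R) (f : R -> R) (A : R) :
  (forall z, intensity y N (r N + z) @[N --> \oo] --> f z) ->
  (\forall N \near \oo, forall z, intensity y N (r N + z) <= expR (A * `|z|)) ->
  \sum_(s : Sigma N) gauss_gap R phi y N (r N) s @[N --> \oo]
    --> \int[mu]_z (laplace_gap R phi z * f z).
Proof.
move=> cvg_f bound.
have [N0 _ hN0] : \forall N \near \oo, (0 < N)%N /\
    forall z, intensity y N (r N + z) <= expR (A * `|z|).
  by apply: filterI => //; exists 1%N.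
pose u n (z : R) := laplace_gap R phi z * intensity y (n + N0) (r (n + N0)%N + z).
have posN n : (0 < n + N0)%N by have [] := hN0 (n + N0)%N (leq_addl _ _).
have mgap := measurable_laplace_gap R phi tphi.
have mdens n : measurable_fun [set: R] (fun z => intensity y (n + N0) (r (n + N0)%N + z)).
  apply: (@measurableT_comp _ _ _ _ _ _ (intensity y (n + N0))).
    exact: continuous_measurable_fun (continuous_intensity R y (n + N0)).
  exact: measurable_funD.
have mf : measurable_fun [set: R] f.
  apply: (@measurable_fun_cvg _ _ _ _
    (fun n z => intensity y (n + N0) (r (n + N0)%N + z))) => // z _.
  by rewrite (cvg_shiftn N0 (fun N => intensity y N (r N + z))).
have iE : mu.-integrable [set: R] (EFin \o (fun z => laplace_gap R phi z * expR (A * `|z|))).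
  apply: integrable_laplace_gap_mul => //.
    apply: measurableT_comp => //; apply: measurable_funM => //.
  move=> D; exists (expR (`|A| * `|D|)) => z zD.
  rewrite ger0_norm ?expR_ge0// ler_expR; apply: (le_trans (ler_norm _)).
  by rewrite normrM normr_id ler_wpM2l// (le_trans zD)// ler_norm.
have dens0 n z : 0 <= intensity y (n + N0) (r (n + N0)%N + z).
  by apply: sumr_ge0 => s _; rewrite mulr_ge0 ?expR_ge0// ltW// gauss_peak_gt0.
have [|||||iF _ lim] := @dominated_convergence _ _ _ lebesgue_measure [set: R] measurableT
  (fun n => EFin \o u n) (EFin \o (fun z => laplace_gap R phi z * f z))
  (EFin \o (fun z => laplace_gap R phi z * expR (A * `|z|))).
- by move=> n; apply/measurable_EFinP; exact: (measurable_funM mgap (mdens n)).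
- by apply/measurable_EFinP; exact: (measurable_funM mgap mf).
- apply: aeW => z _; apply: cvg_EFin; first exact: nearW.
  apply: cvgM; first exact: cvg_cst.
  by rewrite (cvg_shiftn N0 (fun N => intensity y N (r N + z))).
- exact: iE.
- apply: aeW => z n _ /=; rewrite lee_fin normrM (ger0_norm (laplace_gap_ge0 R phi tphi z)).
  apply: ler_wpM2l; first exact: laplace_gap_ge0.
  rewrite ger0_norm//; have [_] := hN0 (n + N0)%N (leq_addl _ _); exact.
rewrite -(cvg_shiftn N0 (fun N => \sum_(s : Sigma N) gauss_gap R phi y N (r N) s)).
have : (\sum_(s : Sigma (n + N0)) gauss_gap R phi y (n + N0) (r (n + N0)%N) s)%:E
    @[n --> \oo] --> (\int[mu]_z (laplace_gap R phi z * f z))%:E.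
  rewrite /Rintegral fineK; last exact: (integrable_fin_num measurableT iF).
  apply: cvg_trans lim; apply: near_eq_cvg; apply: nearW => n.
  by rewrite sum_gauss_gap.
by move=> /fine_cvg.
Qed.

Lemma cvg_laplace_product (y : nat -> R) (r : nat -> R) (b A : R) :
  (forall z, intensity y N (r N + z) @[N --> \oo] --> expR (- b * z)) ->
  (\forall N \near \oo, forall z, intensity y N (r N + z) <= expR (A * `|z|)) ->
  \prod_(s : Sigma N) (1 - gauss_gap R phi y N (r N) s) @[N --> \oo]
    --> laplace_poisson (fun z => 1 * expR (- b * z)) phi.
Proof.
move=> hd hb; rewrite /laplace_poisson.
apply: (@cvg_prod_1B _ (fun N => Sigma N) (fun N s => gauss_gap R phi y N (r N) s)
  (fun N => gauss_peak R N * \int[mu]_z laplace_gap R phi z)).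
- near=> N => s; apply: gauss_gap_bounds => //; near: N; exists 1%N => //.
- rewrite -[X in _ --> X](mul0r (\int[mu]_z laplace_gap R phi z)).
  by apply: cvgM; [exact: gauss_peak_cvg0|exact: cvg_cst].
- under eq_Rintegral do rewrite mul1r.
  exact: cvg_sum_gauss_gap hb.
Unshelve. all: by end_near. Qed.

End poisson_limit.

(** * Conditioning on the field, and the theorem *)

Lemma measurable_field_energy (R : realType) N (s : Sigma N) :
  measurable_fun setT (fun y : path_space nat R => field_energy y N s).
Proof.
apply: measurable_sum => i; apply: measurable_funM => //.
exact: measurable_coord.
Qed.

Lemma measurable_intensity (R : realType) N (a : R) :
  measurable_fun setT (fun y : path_space nat R => intensity y N a).
Proof.
apply: measurable_sum => s; apply: measurable_funM => //; apply: measurableT_comp => //.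
apply: measurable_funM => //; apply: measurableT_comp => //; apply: measurable_funX.
by apply: measurable_funB => //; exact: measurable_field_energy.
Qed.

Lemma measurable_level (R : realType) N : (0 < N)%N ->
  measurable_fun setT (fun y : path_space nat R => level R y N).
Proof.
move=> N0; apply: measurable_fun_sups.
  by move=> y _; exact: level_candidate_ub.
move=> n; rewrite /level_candidate; case: unpickle => [q|//].
have [q0|q0] := boolP (0 <= ratr q :> R) => //=.
by apply: measurable_fun_ifT => //; apply: measurable_fun_ltr => //; exact: measurable_intensity.
Qed.

Section laplace_of_law.
Context d (T : measurableType d) (R : realType) (P : probability T R).
Variables (N : nat) (X : Sigma N -> {RV P >-> R}).
Hypothesis N0 : (0 < N)%N.
Hypothesis X_indep : independent_family P (fun s : Sigma N => X s : T -> R).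
Hypothesis X_gauss : forall (s : Sigma N) (A : set R), measurable A ->
  distribution P (X s) A = normal_prob 0 (Num.sqrt (N%:R : R)) A.

Lemma laplace_shifted_gauss (m : {measure set (path_space (Sigma N) R) -> \bar R})
    (y : nat -> R) (r : R) (phi : R -> R) : test_function phi ->
  (forall B, measurable B -> m B = P [set w | B (fun s => X s w + field_energy y N s)]) ->
  laplace_shifted m r phi = \prod_s (1 - gauss_gap R phi y N r s).
Proof.
move=> tphi mE.
have mF : measurable_fun setT
    ((fun w s => X s w + field_energy y N s) : T -> path_space (Sigma N) R).
  by apply: measurable_fun_path => s; apply: measurable_funD.
pose F : {mfun T >-> path_space (Sigma N) R} :=
  HB.pack ((fun w s => X s w + field_energy y N s) : T -> path_space (Sigma N) R)
   (isMeasurableFun.Build _ _ _ _ _ mF).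
have mphi : measurable_fun [set: R] phi.
  by have [cphi _ _] := tphi; exact: continuous_measurable_fun.
have mL : measurable_fun setT (fun x : path_space (Sigma N) R => expR (- \sum_s phi (x s - r))).
  apply: measurableT_comp => //; apply: measurableT_comp => //.
  apply: measurable_sum => s; apply: (measurableT_comp mphi).
  by apply: measurable_funB => //; exact: measurable_coord.
rewrite /laplace_shifted /Rintegral.
rewrite (@eq_measure_integral _ _ _ _ (distribution P F)); last by move=> A mA _; exact: mE.
rewrite ge0_integral_distribution; last 2 first.
- exact/measurable_EFinP.
- by move=> x; rewrite lee_fin expR_ge0.
transitivity (fine (\prod_s (1 - gauss_gap R phi y N r s))%:E) => //; congr fine.
rewrite -(@expectation_prod_independent _ _ _ P _ X X_indep _
  (fun s x => expR (- phi (x + field_energy y N s - r)))).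
- by apply: eq_integral => w _ /=; rewrite -expR_sum sumrN.
- exact: index_enum_uniq.
- move=> s; apply: measurableT_comp => //; apply: measurableT_comp => //.
  apply: (measurableT_comp mphi); apply: measurable_funB => //.
  exact: measurable_funD.
- by move=> s x; exact: expR_ge0.
- by move=> s _; apply: expectation_expR_shift => //; exact: X_gauss.
Qed.

End laplace_of_law.

Theorem theorem2 (R : realType) (d : measure_display) (T : measurableType d)
  (P : probability T R)
  (X : forall N : nat, Sigma N -> {RV P >-> R})
  (h : nat -> {RV P >-> R})
  (beta_c : R)
  (X_indep : forall N : nat, independent_family P (fun s : Sigma N => X N s))
  (X_gauss : forall (N : nat) (s : Sigma N) (A : set R), (0 < N)%N ->
     measurable A ->
     distribution P (X N s) A = normal_prob 0 (Num.sqrt (N%:R : R)) A)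
  (h_indep : independent_family P (fun i : nat => h i))
  (h_ident : forall (i : nat) (A : set R), measurable A ->
     distribution P (h i) A = distribution P (h 0%N) A)
  (hX_indep : independent_pair P (sample_path (fun i : nat => h i))
     (sample_path (fun i : {N : nat & Sigma N} => X (tag i) (tagged i))))
  (h_mgf : forall t : R, ('M_P (h 0%N) t < +oo)%E)
  (beta_cE : self_consistent P (h 0%N) beta_c) :
  exists (c1 c2 : nat -> path_space nat R -> R) (C : R),
    let r (N : nat) (y : path_space nat R) : R :=
      c1 N y * N%:R - c2 N y * ln N%:R in
    let hs : T -> path_space nat R := sample_path (fun i : nat => h i) in
    let H (N : nat) : Sigma N -> T -> R :=
      hamiltonian (fun N (s : Sigma N) => X N s) (fun i => h i) (N := N) in
    [/\ 0 < C,
        forall N : nat, measurable_fun setT (c1 N) /\ measurable_fun setT (c2 N),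
        forall k : (forall N : nat,
            R.-pker (path_space nat R) ~> (path_space (Sigma N) R)),
          (forall N : nat, cond_law P (sample_path (H N)) hs (k N)) ->
          {ae P, forall w : T, forall phi : R -> R, test_function phi ->
             laplace_shifted (k N (hs w)) (r N (hs w)) phi @[N --> \oo]
             --> laplace_poisson (fun z => C * expR (- beta_c * z)) phi}
      & {ae P, forall w : T,
           c1 N (hs w) @[N --> \oo] --> E_max P (h 0%N) beta_c /\
           c2 N (hs w) @[N --> \oo] --> (2 * beta_c)^-1}].
Proof.
have [b0 _] := self_consistentP _ _ _ _ _ _ beta_cE.
have level_ae := ae_level_intensity _ _ _ _ h beta_c h_indep h_ident h_mgf beta_cE.
pose c2 : R := (2 * beta_c)^-1.
(* For N > 0 this makes r N the level. *)
exists (fun N y => (level R y N + c2 * ln N%:R) / N%:R), (fun _ _ => c2), 1.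
move=> r hs H.
have rE N y : (0 < N)%N -> r N y = level R y N.
  by move=> N0; rewrite /r divfK ?addrK// pnatr_eq0 -lt0n.
split.
- exact: ltr01.
- move=> N; split => //; have [->|N0] := posnP N.
    rewrite (_ : (fun y : nat -> R => _) = cst 0)//.
    by apply/funext => y; rewrite invr0 mulr0.
  by apply: measurable_funM => //; apply: measurable_funD => //; exact: measurable_level.
- move=> k kP.
  have mU : measurable_fun setT hs by apply: measurable_fun_path.
  pose U : {mfun T >-> path_space nat R} := HB.pack hs (isMeasurableFun.Build _ _ _ _ _ mU).
  pose xs : T -> path_space {N & Sigma N} R :=
    sample_path (fun i : {N : nat & Sigma N} => X (tag i) (tagged i)).
  have mV : measurable_fun setT xs by apply: measurable_fun_path => i; exact: measurable_funP.
  pose V : {mfun T >-> path_space {N & Sigma N} R} :=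
    HB.pack xs (isMeasurableFun.Build _ _ _ _ _ mV).
  have law_ae : {ae P, forall w, forall N, forall B, measurable B ->
      k N (hs w) B = P [set w' | B (fun s => X N s w' + field_energy (hs w) N s)]}.
    apply: ae_foralln => N.
    pose Phi (p : path_space nat R * path_space {N & Sigma N} R) : path_space (Sigma N) R :=
      fun s => p.2 (existT _ N s) + field_energy p.1 N s.
    apply: (@cond_law_independent _ _ _ P _ _ _ _ U V hX_indep (Sigma N) Phi (k N)).
    + apply: measurable_fun_path => s; apply: measurable_funD.
        exact: (measurableT_comp (measurable_coord _ _ _) measurable_snd).
      exact: (measurableT_comp (measurable_field_energy _ _ _) measurable_fst).
    + exact: kP.
  apply: filterS2 level_ae law_ae => w [_ cvg_dens [A bound]] law phi tphi.
  have := cvg_laplace_product _ _ tphi _ _ _ _ cvg_dens bound.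
  apply: cvg_trans; apply: near_eq_cvg; near=> N.
  have N0 : (0 < N)%N by near: N; exists 1%N.
  by rewrite rE//; apply/esym; exact: (laplace_shifted_gauss _ _ _ _ _ (X N) N0 (X_indep N)
    (fun s A mA => X_gauss N s A N0 mA) _ _ _ _ tphi (law N)).
- apply: filterS level_ae => w [cvg_l _ _]; split; last exact: cvg_cst.
  rewrite -[X in _ --> X]addr0 -[X in _ --> _ + X](mulr0 c2).
  under eq_fun do rewrite mulrDl -mulrA.
  by apply: cvgD => //; apply: cvgM; [exact: cvg_cst|exact: cvg_ln_div].
Unshelve. all: by end_near. Qed.
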